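(* Let $\mathcal{G}$ be an ultragraph, let $(H,B)$ be an admissible pair in $\mathcal{G}$, and let $\mathcal{G}/(H,B)$ be the quotient ultragraph, with $C^*(\mathcal{G}/(H,B))=C^*(t_e,q_{[A]})$ and gauge action $\gamma$. Let $\{T_e,Q_{[A]}\}$ be a representation of $\mathcal{G}/(H,B)$ in a $C^*$-algebra such that $Q_{[A]}\neq 0$ for every $[A]\neq[\emptyset]$, and let $C^*(T_e,Q_{[A]})$ be the $C^*$-algebra it generates. Let $\pi_{T,Q}:C^*(\mathcal{G}/(H,B))\to C^*(T_e,Q_{[A]})$ be the $*$-homomorphism satisfying $\pi_{T,Q}(t_e)=T_e$ and $\pi_{T,Q}(q_{[A]})=Q_{[A]}$. If there is a strongly continuous action $\beta$ of $\mathbb{T}$ on $C^*(T_e,Q_{[A]})$ such that $\beta_z\circ\pi_{T,Q}=\pi_{T,Q}\circ\gamma_z$ for every $z\in\mathbb{T}$, then $\pi_{T,Q}$ is faithful (injective).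
   Context: An ultragraph $\mathcal{G}=(G^0,\mathcal{G}^1,r_{\mathcal{G}},s_{\mathcal{G}})$ consists of a countable vertex set $G^0$, a countable edge set $\mathcal{G}^1$, a source map $s_{\mathcal{G}}:\mathcal{G}^1\to G^0$ and a range map $r_{\mathcal{G}}:\mathcal{G}^1\to\mathcal{P}(G^0)\setminus\{\emptyset\}$. $\mathcal{G}^0$ is the smallest collection of subsets of $G^0$ containing all $\{v\}$ ($v\in G^0$) and all $r_{\mathcal{G}}(e)$ ($e\in\mathcal{G}^1$) and closed under $\cap,\cup,\setminus$. Singletons $\{v\}$ are written $v$; for a collection $H$ of sets, $v\in H$ means $\{v\}\in H$, and $G^0\setminus H$ is the set of vertices $v$ with $\{v\}\notin H$. A (nonempty) collection $H\subseteq\mathcal{G}^0$ is hereditary if (1) $s_{\mathcal{G}}(e)\in H$ implies $r_{\mathcal{G}}(e)\in H$; (2) $A,B\in H$ implies $A\cup B\in H$; (3) $A\in H$, $B\in\mathcal{G}^0$, $B\subseteq A$ imply $B\in H$ (so $\emptyset\in H$). It is saturated if for each $v\in G^0$ with $0<|s_{\mathcal{G}}^{-1}(v)|<\infty$, $r_{\mathcal{G}}(e)\in H$ for all $e\in s_{\mathcal{G}}^{-1}(v)$ implies $v\in H$. For $H$ saturated hereditary, $B_H:=\{w\in G^0: |s_{\mathcal{G}}^{-1}(w)|=\infty,\ 0<|\{e: s_{\mathcal{G}}(e)=w,\ r_{\mathcal{G}}(e)\notin H\}|<\infty\}$. An admissible pair $(H,B)$ is a saturated hereditary $H\subseteq\mathcal{G}^0$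 with a subset $B\subseteq B_H$. Extended ultragraph $\overline{\mathcal{G}}=(\overline{G}^0,\overline{\mathcal{G}}^1,r',s')$ of $(H,B)$: $\overline{G}^0:=G^0\cup\{w':w\in B_H\setminus B\}$ (new vertices $w'$), $\overline{\mathcal{G}}^1:=\mathcal{G}^1$, $\overline{A}:=A\cup\{w':w\in A\cap(B_H\setminus B)\}$ for $A\in\mathcal{G}^0$, $r'(e):=\overline{r_{\mathcal{G}}(e)}$, and $s'(e):=(s_{\mathcal{G}}(e))'$ if $s_{\mathcal{G}}(e)\in B_H\setminus B$ and $r_{\mathcal{G}}(e)\in H$, $s'(e):=s_{\mathcal{G}}(e)$ otherwise. $\overline{\mathcal{G}}^0$ is the corresponding algebra of subsets of $\overline{G}^0$; $H\subseteq\overline{\mathcal{G}}^0$. On $\overline{\mathcal{G}}^0$ put $C\sim D$ iff $C\cup V=D\cup V$ for some $V\in H$; this is an equivalence relation, with classes $[C]$, and $\cup,\cap,\setminus$ descend to classes. $[C]\subseteq[D]$ means $[C]\cap[D]=[C]$; $[v]$ means $[\{v\}]$. Quotient ultragraph $\mathcal{G}/(H,B)=(\Phi(G^0),\Phi(\mathcal{G}^0),\Phi(\mathcal{G}^1),r,s)$: $\Phi(G^0):=\{[v]:v\in G^0\setminus H\}\cup\{[w']:w\in B_H\setminus B\}$, $\Phi(\mathcal{G}^0):=\{[A]:A\in\overline{\mathcal{G}}^0\}$, $\Phi(\mathcal{G}^1):=\{e\in\overline{\mathcal{G}}^1:r'(e)\notin H\}$, $r(e):=[r'(e)]$, $s(e):=[s'(e)]$.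 A representation of $\mathcal{G}/(H,B)$ is a set of partial isometries $\{T_e:e\in\Phi(\mathcal{G}^1)\}$ and projections $\{Q_{[A]}:[A]\in\Phi(\mathcal{G}^0)\}$ in a $C^*$-algebra with (1) $Q_{[\emptyset]}=0$, $Q_{[A\cap B]}=Q_{[A]}Q_{[B]}$, $Q_{[A\cup B]}=Q_{[A]}+Q_{[B]}-Q_{[A\cap B]}$; (2) $T_e^*T_e=Q_{r(e)}$ and $T_e^*T_f=0$ for $e\neq f$; (3) $T_eT_e^*\leq Q_{s(e)}$; (4) $Q_{[v]}=\sum_{s(e)=[v]}T_eT_e^*$ for $[v]\in\Phi(G^0)$ with $0<|s^{-1}([v])|<\infty$. $C^*(\mathcal{G}/(H,B))$ is the universal $C^*$-algebra generated by a representation $\{t_e,q_{[A]}\}$. Its gauge action is the strongly continuous action $\gamma$ of $\mathbb{T}$ with $\gamma_z(t_e)=zt_e$, $\gamma_z(q_{[A]})=q_{[A]}$. *)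

(* Defs.v *)
From HB Require Import structures.
From mathcomp Require Import all_boot all_order all_algebra.
From mathcomp Require Import all_classical all_reals all_analysis.
From mathcomp Require Export complex.

Set Implicit Arguments.
Unset Strict Implicit.
Unset Printing Implicit Defensive.

Import Order.TTheory GRing.Theory Num.Theory numFieldNormedType.Exports.

Local Open Scope classical_set_scope.
Local Open Scope ring_scope.

(* A C*-algebra need not be unital (and may be {0}), so MathComp's algebras,
   which carry a unit, cannot be used.  The norm takes its values in R[i]; these
   are automatically real and nonnegative. *)
HB.mixin Record isCStarAlgebra (R : realType) A
    of CompleteNormedModule R[i] A := {
  cmul : A -> A -> A;
  cadj : A -> A;
  cmulA : forall x y z, cmul x (cmul y z) = cmul (cmul x y) z;
  cmulDl : forall x y z, cmul (x + y) z = cmul x z + cmul y z;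
  cmulDr : forall x y z, cmul x (y + z) = cmul x y + cmul x z;
  cmulZl : forall (a : R[i]) x y, cmul (a *: x) y = a *: cmul x y;
  cmulZr : forall (a : R[i]) x y, cmul x (a *: y) = a *: cmul x y;
  cadjK : forall x, cadj (cadj x) = x;
  cadjD : forall x y, cadj (x + y) = cadj x + cadj y;
  cadjZ : forall (a : R[i]) x, cadj (a *: x) = Num.conj a *: cadj x;
  cadjM : forall x y, cadj (cmul x y) = cmul (cadj y) (cadj x);
  cnormM : forall x y, `|cmul x y| <= `|x| * `|y|;
  cnorm_adjM : forall x, `|cmul (cadj x) x| = `|x| ^+ 2
}.

#[short(type="cstarAlgType")]
HB.structure Definition CStarAlgebra (R : realType) :=
  {A of CompleteNormedModule R[i] A & isCStarAlgebra R A}.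

Section CStar.
Variable R : realType.
Local Notation C := R[i].

Section Elements.
Variable A : cstarAlgType R.
Implicit Types (x y : A) (S : set A).

Definition projection x := cmul x x = x /\ cadj x = x.

Definition partial_isometry x := cmul (cmul x (cadj x)) x = x.

(* In a C*-algebra, the positive elements are those of the form c^* c. *)
Definition cle x y := exists c : A, y - x = cmul (cadj c) c.

Definition cstar_subalgebra S :=
  [/\ S 0, (forall (a : C) x y, S x -> S y -> S (a *: x + y)),
      (forall x y, S x -> S y -> S (cmul x y)), (forall x, S x -> S (cadj x))
    & closed S].

Definition cstar_generated (X : set A) : set A := smallest cstar_subalgebra X.

End Elements.

Definition star_hom_on (A B : cstarAlgType R) (D : set A) (f : A -> B) :=
  [/\ (forall (a : C) x y, D x -> D y -> f (a *: x + y) = a *: f x + f y),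
      (forall x y, D x -> D y -> f (cmul x y) = cmul (f x) (f y))
    & (forall x, D x -> f (cadj x) = cadj (f x))].

Definition star_hom (A B : cstarAlgType R) (f : A -> B) := star_hom_on setT f.

Definition circle : set C := [set z : C | `|z| = 1].

(* A strongly continuous action of the circle by *-automorphisms of the
   C*-subalgebra D of A; only the values beta z x with z on the circle and
   x in D are meaningful.  The ascription to numFieldType is what gives R[i] its
   topology. *)
Definition circle_action_on (A : cstarAlgType R) (D : set A)
    (beta : C -> A -> A) :=
  [/\ (forall z, circle z ->
         (forall x, D x -> D (beta z x)) /\ star_hom_on D (beta z)),
      (forall x, D x -> beta 1 x = x),
      (forall z w x, circle z -> circle w -> D x ->
         beta (z * w) x = beta z (beta w x))
    & (forall x, D x ->
         {within (circle : set (C : numFieldType)), continuous beta^~ x})].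

End CStar.

Record ultragraph := Ultragraph {
  vertex : countType;
  edge : countType;
  range_of : edge -> set vertex;
  source_of : edge -> vertex;
  range_neq0 : forall e, range_of e !=set0
}.

(* The algebra written G^0 in calligraphic type. *)
Definition algebra0 (G : ultragraph) : set (set (vertex G)) :=
  smallest [set M : set (set (vertex G)) |
             [/\ setI_closed M, setU_closed M & setD_closed M]]
    ([set [set v] | v in [set: vertex G]] `|` [set range_of e | e in [set: edge G]]).

Definition hereditary (G : ultragraph) (H : set (set (vertex G))) :=
  [/\ H !=set0, H `<=` @algebra0 G,
      (forall e : edge G, H [set source_of e] -> H (range_of e)),
      (forall A B, H A -> H B -> H (A `|` B))
    & (forall A B, H A -> algebra0 B -> B `<=` A -> H B)].

Definition emits (G : ultragraph) (v : vertex G) : set (edge G) :=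
  [set e | source_of e = v].

Definition saturated (G : ultragraph) (H : set (set (vertex G))) :=
  forall v : vertex G, emits v !=set0 -> finite_set (emits v) ->
    (forall e, emits v e -> H (range_of e)) -> H [set v].

Definition breaking (G : ultragraph) (H : set (set (vertex G)))
    : set (vertex G) :=
  [set w | [/\ infinite_set (emits w),
               emits w `&` [set e | ~ H (range_of e)] !=set0
             & finite_set (emits w `&` [set e | ~ H (range_of e)])]].

Definition admissible (G : ultragraph) (H : set (set (vertex G)))
    (B : set (vertex G)) :=
  [/\ hereditary H, saturated H & B `<=` breaking H].

Section Quotient.
Variables (G : ultragraph) (H : set (set (vertex G))) (B : set (vertex G)).

(* The summand on the right consists of the new vertices w'. *)
Definition ext_vertex : countType := (vertex G + (breaking H `\` B))%type.

Definition bar (A : set (vertex G)) : set ext_vertex :=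
  [set x | match x with inl v => A v | inr w => A (val w) end].

Definition ext_source (e : edge G) : ext_vertex :=
  if insub (source_of e) is Some w
  then if pselect (H (range_of e)) then inr w else inl (source_of e)
  else inl (source_of e).

Lemma bar_range_neq0 (e : edge G) : bar (range_of e) !=set0.
Proof. by have [v ve] := range_neq0 e; exists (inl v). Qed.

Definition extended_ultragraph : ultragraph :=
  Ultragraph ext_source bar_range_neq0.

Local Notation vbar := (vertex extended_ultragraph).

(* H as a collection of sets of vertices of the extended ultragraph. *)
Definition ext_ideal : set (set vbar) :=
  [set [set (inl v : vbar) | v in A] | A in H].

Definition ext_equiv (C D : set vbar) :=
  exists2 V, ext_ideal V & C `|` V = D `|` V.

(* The class [C] of the relation ext_equiv on algebra0 extended_ultragraph. *)
Definition qclass (C : set vbar) : set (set vbar) :=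
  [set D | algebra0 D /\ ext_equiv C D].

Definition qvertex : set (set (set vbar)) :=
  [set qclass [set inl v] | v in [set v : vertex G | ~ H [set v]]]
  `|` [set qclass [set inr w] | w in [set: (breaking H `\` B)]].

Definition qalgebra : set (set (set vbar)) :=
  [set qclass A | A in @algebra0 extended_ultragraph].

Definition qedge : set (edge G) :=
  [set e | ~ ext_ideal (range_of (e : edge extended_ultragraph))].

Definition qrange (e : edge G) : set (set vbar) :=
  qclass (range_of (e : edge extended_ultragraph)).

Definition qsource (e : edge G) : set (set vbar) :=
  qclass [set source_of (e : edge extended_ultragraph)].

Definition qemits (v : set (set vbar)) : set (edge G) :=
  qedge `&` [set e | qsource e = v].

Section Representation.
Variables (R : realType) (A : cstarAlgType R).
Variables (T : edge G -> A) (Q : set (set vbar) -> A).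

(* T and Q are total functions, but only their values on the quotient edges and
   on the classes in qalgebra matter. *)
Record representation : Prop := {
  rep_partial_isometry : forall e, qedge e -> partial_isometry (T e);
  rep_projection : forall a, qalgebra a -> projection (Q a);
  rep_set0 : Q (qclass set0) = 0;
  rep_setI : forall C D : set vbar, algebra0 C -> algebra0 D ->
    Q (qclass (C `&` D)) = cmul (Q (qclass C)) (Q (qclass D));
  rep_setU : forall C D : set vbar, algebra0 C -> algebra0 D ->
    Q (qclass (C `|` D)) = Q (qclass C) + Q (qclass D) - Q (qclass (C `&` D));
  rep_range : forall e, qedge e -> cmul (cadj (T e)) (T e) = Q (qrange e);
  rep_orthogonal : forall e f, qedge e -> qedge f -> e <> f ->
    cmul (cadj (T e)) (T f) = 0;
  rep_source : forall e, qedge e ->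
    cle (cmul (T e) (cadj (T e))) (Q (qsource e));
  rep_sum : forall v, qvertex v -> qemits v !=set0 -> finite_set (qemits v) ->
    Q v = \sum_(e \in qemits v) cmul (T e) (cadj (T e))
}.

Definition rep_algebra : set A :=
  cstar_generated ([set T e | e in qedge] `|` [set Q a | a in qalgebra]).

End Representation.

(* A, together with (t, q), is C^*(G/(H,B)). *)
Definition universal_representation (R : realType) (A : cstarAlgType R)
    (t : edge G -> A) (q : set (set vbar) -> A) :=
  [/\ representation t q, rep_algebra t q = setT
    & forall (D : cstarAlgType R) (T : edge G -> D)
        (Q : set (set vbar) -> D), representation T Q ->
      exists pi : A -> D, [/\ star_hom pi,
        (forall e, qedge e -> pi (t e) = T e)
        & (forall a, qalgebra a -> pi (q a) = Q a)]].

Definition gauge_action (R : realType) (A : cstarAlgType R)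
    (t : edge G -> A) (q : set (set vbar) -> A)
    (gamma : R[i] -> A -> A) :=
  [/\ circle_action_on setT gamma,
      (forall z e, circle z -> qedge e -> gamma z (t e) = z *: t e)
    & (forall z a, circle z -> qalgebra a -> gamma z (q a) = q a)].

End Quotient.

(* Main.v *)
Require Import Defs.
From HB Require Import structures.
From mathcomp Require Import all_boot all_order all_algebra.
From mathcomp Require Import all_classical all_reals all_analysis.
From mathcomp Require Import ring lra.

Set Implicit Arguments.
Unset Strict Implicit.
Unset Printing Implicit Defensive.

Import Order.TTheory GRing.Theory Num.Theory numFieldNormedType.Exports.

Local Open Scope classical_set_scope.
Local Open Scope ring_scope.

(** The theorem is the gauge-invariant uniqueness theorem, and its proof rests on
    one device.  If h is self-adjoint in a C*-algebra, the C*-identity gives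
    |h^(2^n)| = |h|^(2^n); hence an inequality |h^(2^n)| <= K 2^n |pi (h^(2^n))|
    for all n already implies |h| <= |pi h| (nrm_sqn, le_of_powers,
    isometric_of_powers).  Estimates with a bad constant are therefore enough,
    and neither spectral theory nor integration over the circle is needed.

    The C*-algebra A is the closure of the span of the monomials t_mu p t_nu^*,
    of degree |mu| - |nu| (monomial_mul, adherent_subalgebra).  As pi is
    contractive (hom_contractive), it suffices that pi does not decrease norms on
    this span.

    - Degree zero.  Finitely many monomials of degree zero lie in a *-algebra
      described by finite data (core): projections taken from a finite list, and
      matrices whose entries lie in a smaller algebra of the same kind, indexed by
      the edges in a finite set s.  There |x| <= K |pi x| with K depending only
      on the data (core_bound): compression to the ranges of the edges in s is
      handled by induction, and the complement involves only projections of the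
      form p - p (sum_(e in s) t_e t_e^* ).  Such a projection vanishes if its image
      does (range_sum_faithful), because the projections of the Boolean algebra
      are not killed by pi and because s can be enlarged so that each source of
      an edge in s is either fully covered by s or emits an edge outside s.  The
      power device turns K into 1.

    - Homogeneous elements.  If x has a degree then x^* x has degree zero, so the
      C*-identity gives |x| <= |pi x| (homogeneous_isometric).

    - Bounded degree.  If all degrees of x are at most d in absolute value, x is
      split according to the residues of the degrees modulo 2, 4, 8 and so on.
      Each splitting uses one gauge automorphism gamma_w with w^(2^m) = -1, which
      is intertwined with the contraction beta_w, and costs a factor 2.  After about
      log_2 d steps the pieces are homogeneous, so |x| <= K |pi x| with K of order
      d (residue_bound).  The degrees of (x^* x)^(2^n) grow like 2^n, and so the
      power device again removes the constant (algebraic_isometric).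

    Two facts on C*-algebras remain.  A *-homomorphism is bounded because a small
    self-adjoint h is the imaginary part of some w with 1 + w unitary, and
    w + w^* + w^* w = 0 bounds the image of w (hom_bounded_small).  The relation
    t_e t_e^* <= q_s(e) gives q_s(e) t_e = t_e because x^* x + y^* y = 0 forces
    x = 0 (sum_adjM_eq0). *)

(** * Linear identities as identities in a commutative ring *)

Section SquareZero.
Variables (K : comNzRingType) (V : lmodType K).

(** The square-zero extension of K by the module V, in which the product of two
    vectors vanishes.  It is a commutative ring that contains V, so a linear
    identity between vectors can be handed to the ring tactic. *)
Record sqzero := SqZero { sqz_scalar : K; sqz_vector : V }.

Definition sqz_pair (u : sqzero) := (sqz_scalar u, sqz_vector u).
Definition pair_sqz (p : K * V) := SqZero p.1 p.2.
Lemma sqz_pairK : cancel sqz_pair pair_sqz. Proof. by case. Qed.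
HB.instance Definition _ := Choice.copy sqzero (can_type sqz_pairK).

Definition sqz_add u v :=
  SqZero (sqz_scalar u + sqz_scalar v) (sqz_vector u + sqz_vector v).
Definition sqz_opp u := SqZero (- sqz_scalar u) (- sqz_vector u).
Definition sqz_mul u v := SqZero (sqz_scalar u * sqz_scalar v)
  (sqz_scalar u *: sqz_vector v + sqz_scalar v *: sqz_vector u).

Lemma sqz_addA : associative sqz_add.
Proof. by move=> [? ?] [? ?] [? ?]; rewrite /sqz_add /= !addrA. Qed.
Lemma sqz_addC : commutative sqz_add.
Proof. by move=> [? ?] [? ?]; congr SqZero; exact: addrC. Qed.
Lemma sqz_add0 : left_id (SqZero 0 0) sqz_add.
Proof. by move=> [? ?]; rewrite /sqz_add /= !add0r. Qed.
Lemma sqz_addN : left_inverse (SqZero 0 0) sqz_opp sqz_add.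
Proof. by move=> [? ?]; rewrite /sqz_add /= !addNr. Qed.
HB.instance Definition _ :=
  GRing.isZmodule.Build sqzero sqz_addA sqz_addC sqz_add0 sqz_addN.

Lemma sqz_mulA : associative sqz_mul.
Proof.
move=> [a x] [b y] [c z]; congr SqZero => /=; first exact: mulrA.
by rewrite !scalerDr !scalerA addrA (mulrC c a) (mulrC c b).
Qed.
Lemma sqz_mulC : commutative sqz_mul.
Proof.
by move=> [a x] [b y]; congr SqZero => /=; [exact: mulrC|exact: addrC].
Qed.
Lemma sqz_mul1 : left_id (SqZero 1 0) sqz_mul.
Proof.
by move=> [a x]; rewrite /sqz_mul /= mul1r scale1r scaler0 addr0.
Qed.
Lemma sqz_mulD : left_distributive sqz_mul +%R.
Proof.
move=> [a x] [b y] [c z]; congr SqZero => /=; first exact: mulrDl.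
by rewrite scalerDl scalerDr addrACA.
Qed.
Lemma sqz_1n0 : SqZero 1 0 != 0 :> sqzero.
Proof. by apply/eqP => -[/eqP]; rewrite oner_eq0. Qed.
HB.instance Definition _ := GRing.Zmodule_isComNzRing.Build sqzero
  sqz_mulA sqz_mulC sqz_mul1 sqz_mulD sqz_1n0.

Definition vec (x : V) := SqZero 0 x.
Definition scal (a : K) := SqZero a 0.

Lemma vec_inj : injective vec. Proof. by move=> x y []. Qed.
Lemma vecD x y : vec (x + y) = vec x + vec y.
Proof. by rewrite /vec; congr SqZero; rewrite /= addr0. Qed.
Lemma vecN x : vec (- x) = - vec x.
Proof. by rewrite /vec; congr SqZero; rewrite /= oppr0. Qed.
Lemma vec0 : vec 0 = 0. Proof. by []. Qed.
Lemma vecZ a x : vec (a *: x) = scal a * vec x.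
Proof. by rewrite /vec; congr SqZero; rewrite /= ?mulr0 // scale0r addr0. Qed.
Lemma scalD a b : scal (a + b) = scal a + scal b.
Proof. by rewrite /scal; congr SqZero; rewrite /= addr0. Qed.
Lemma scalN a : scal (- a) = - scal a.
Proof. by rewrite /scal; congr SqZero; rewrite /= oppr0. Qed.
Lemma scalM a b : scal (a * b) = scal a * scal b.
Proof. by rewrite /scal; congr SqZero; rewrite /= !scaler0 addr0. Qed.
Lemma scal1 : scal 1 = 1. Proof. by []. Qed.
Lemma scal0 : scal 0 = 0. Proof. by []. Qed.
Lemma vecMn x n : vec (x *+ n) = vec x *+ n.
Proof. by elim: n => [|n IH]; rewrite ?mulr0n ?vec0 // !mulrS vecD IH. Qed.
Lemma scalMn x n : scal (x *+ n) = scal x *+ n.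
Proof. by elim: n => [|n IH]; rewrite ?mulr0n ?scal0 // !mulrS scalD IH. Qed.
Definition vecE := (vecD, vecN, vec0, vecZ, vecMn, scalD, scalN, scalM, scal1, scal0, scalMn).
End SquareZero.

Ltac linear_ring := apply: vec_inj; rewrite !vecE; ring.

(** * Elementary norm estimates in C*-algebras *)

Section Basics.
Variable R : realType.
Local Notation C := R[i].
Variable A : cstarAlgType R.
Implicit Types (x y z h : A).

Local Notation "x ** y" := (@cmul R A x y) (at level 40, left associativity).
Local Notation "x ^#" := (@cadj R A x) (at level 2, format "x ^#").

Lemma cmul0l x : 0 ** x = 0.
Proof. by have := cmulZl 0 0 x; rewrite !scale0r. Qed.
Lemma cmul0r x : x ** 0 = 0.
Proof. by have := cmulZr 0 x 0; rewrite !scale0r. Qed.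
Lemma cmulNl x y : (- x) ** y = - (x ** y).
Proof. by rewrite -scaleN1r cmulZl scaleN1r. Qed.
Lemma cmulNr x y : x ** (- y) = - (x ** y).
Proof. by rewrite -[- y]scaleN1r cmulZr scaleN1r. Qed.
Lemma cmulBl x y z : (x - y) ** z = x ** z - y ** z.
Proof. by rewrite cmulDl cmulNl. Qed.
Lemma cmulBr x y z : z ** (x - y) = z ** x - z ** y.
Proof. by rewrite cmulDr cmulNr. Qed.
Lemma cadj0 : (0 : A)^# = 0.
Proof. by have := @cadjZ R A 0 0; rewrite conjC0 !scale0r. Qed.
Lemma cadjN x : (- x)^# = - x^#.
Proof. by rewrite -scaleN1r cadjZ rmorphN1 scaleN1r. Qed.
Lemma cadjB x y : (x - y)^# = x^# - y^#.
Proof. by rewrite cadjD cadjN. Qed.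

Lemma cmul_suml (I : Type) (s : seq I) (F : I -> A) y :
  (\sum_(i <- s) F i) ** y = \sum_(i <- s) (F i ** y).
Proof.
by elim: s => [|i s IH]; rewrite ?big_nil ?cmul0l // !big_cons cmulDl IH.
Qed.
Lemma cmul_sumr (I : Type) (s : seq I) (F : I -> A) y :
  y ** (\sum_(i <- s) F i) = \sum_(i <- s) (y ** F i).
Proof.
by elim: s => [|i s IH]; rewrite ?big_nil ?cmul0r // !big_cons cmulDr IH.
Qed.
Lemma cadj_sum (I : Type) (s : seq I) (F : I -> A) :
  (\sum_(i <- s) F i)^# = \sum_(i <- s) (F i)^#.
Proof.
by elim: s => [|i s IH]; rewrite ?big_nil ?cadj0 // !big_cons cadjD IH.
Qed.

Definition nrm x : R := complex.Re `|x|.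
Definition cnrm (a : C) : R := complex.Re `|a|.

Lemma nrmE x : `|x| = (nrm x)%:C%C.
Proof. by rewrite /nrm RRe_real // normr_real. Qed.
Lemma cnrmE (a : C) : `|a| = (cnrm a)%:C%C.
Proof. by rewrite /cnrm RRe_real // normr_real. Qed.
Lemma nrm_ge0 x : 0 <= nrm x. Proof. by rewrite -ler0c -nrmE. Qed.
Lemma cnrm_ge0 a : 0 <= cnrm a. Proof. by rewrite -ler0c -cnrmE. Qed.
Lemma nrm0 : nrm 0 = 0. Proof. by rewrite /nrm normr0. Qed.
Lemma nrm_eq0 x : nrm x = 0 -> x = 0.
Proof. by move=> e; apply/normr0_eq0; rewrite nrmE e. Qed.
Lemma nrmD x y : nrm (x + y) <= nrm x + nrm y.
Proof. by rewrite -lecR rmorphD /= -!nrmE ler_normD. Qed.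
Lemma nrmN x : nrm (- x) = nrm x. Proof. by rewrite /nrm normrN. Qed.
Lemma nrmB x y : nrm (x - y) <= nrm x + nrm y.
Proof. by rewrite -(nrmN y) nrmD. Qed.
Lemma nrmBC x y : nrm (x - y) = nrm (y - x).
Proof. by rewrite -nrmN opprB. Qed.
Lemma nrmZ a x : nrm (a *: x) = cnrm a * nrm x.
Proof. by apply: complexI; rewrite rmorphM /= -!nrmE -cnrmE normrZ. Qed.
Lemma nrmM x y : nrm (x ** y) <= nrm x * nrm y.
Proof. by rewrite -lecR rmorphM /= -!nrmE cnormM. Qed.
Lemma nrm_adjM x : nrm (x^# ** x) = nrm x ^+ 2.
Proof. by apply: complexI; rewrite rmorphXn /= -!nrmE cnorm_adjM. Qed.
Lemma cnrmR (r : R) : 0 <= r -> cnrm r%:C%C = r.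
Proof. by move=> r0; apply: complexI; rewrite -cnrmE ger0_norm // ler0c. Qed.

Lemma nrm_adj x : nrm x^# = nrm x.
Proof.
have le y : nrm y <= nrm y^#.
  have := nrmM y^# y; rewrite nrm_adjM expr2.
  case: (ltgtP (nrm y) 0) => [|y0|->]; first by rewrite ltNge nrm_ge0.
    by rewrite ler_pM2r.
  by rewrite nrm_ge0.
by apply/le_anti; rewrite le andbT; have := le x^#; rewrite cadjK.
Qed.

Lemma nrm_sum (I : Type) (s : seq I) (F : I -> A) :
  nrm (\sum_(i <- s) F i) <= \sum_(i <- s) nrm (F i).
Proof.
elim: s => [|i s IH]; first by rewrite !big_nil nrm0.
by rewrite !big_cons (le_trans (nrmD _ _)) // lerD2l.
Qed.

(** The power x^(2^n).  These are the exponents at which the C*-identity can be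
    iterated. *)
Definition sqn n x := iter n (fun y => y ** y) x.

Lemma sqn_adj n x : (sqn n x)^# = sqn n x^#.
Proof. by elim: n => //= n IH; rewrite cadjM IH. Qed.

(** Submultiplicativity of the norm is an equality for the powers 2^n of a
    self-adjoint element, by the C*-identity.  This is why any estimate
    between self-adjoint elements that loses only a factor growing slower than
    every c^(2^n), c > 1, can be improved to the constant 1. *)
Lemma nrm_sqn n h : h^# = h -> nrm (sqn n h) = nrm h ^+ (2 ^ n).
Proof.
move=> hh; elim: n => [|n IH] /=; first by rewrite expr1.
have -> : sqn n h ** sqn n h = (sqn n h)^# ** sqn n h by rewrite sqn_adj hh.
by rewrite nrm_adjM IH -exprM expnSr.
Qed.

End Basics.

(** Otherwise (a/b)^(2^n) = (1 + d)^(2^n) with d > 0, which by Bernoulli's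
    inequality exceeds a multiple of (2^n)^2. *)
Lemma le_of_powers (R : realType) (a b c : R) : 0 <= a -> 0 <= b ->
  (forall n, a ^+ (2 ^ n) <= c * 2 ^+ n * b ^+ (2 ^ n)) -> a <= b.
Proof.
move=> a0 b0 ab; rewrite leNgt; apply/negP => ba.
have {}a0 : 0 < a by apply: le_lt_trans ba.
case: (ltgtP b 0) b0 => // [b0 _|b0 _]; last first.
  by have := ab 0%N; rewrite !expr1 b0 mulr0 leNgt a0.
pose d := a / b - 1.
have d0 : 0 < d by rewrite subr_gt0 ltr_pdivlMr // mul1r.
have e : a / b = 1 + d by rewrite /d addrC subrK.
move: d d0 e => d d0 e.
have bern N : 1 + N%:R * d <= (1 + d) ^+ N.
  elim: N => [|N IH]; first by rewrite mul0r addr0 expr0.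
  rewrite exprS; apply: (@le_trans _ _ ((1 + d) * (1 + N%:R * d))).
    rewrite -natr1 -subr_ge0.
    have -> : (1 + d) * (1 + N%:R * d) - (1 + (N%:R + 1) * d) = N%:R * d ^+ 2.
      by ring.
    by rewrite mulr_ge0 // sqr_ge0.
  by rewrite ler_pM2l // addr_gt0.
have key n : (2 ^+ n) * d ^+ 2 <= 2 * c.
  have := ab n.+1; rewrite -ler_pdivrMr ?exprn_gt0 // -expr_div_n e.
  rewrite expnSr exprM => h1.
  have h2 : (2 ^+ n * d) ^+ 2 <= c * 2 ^+ n.+1.
    apply: le_trans h1; rewrite ler_pXn2r // ?nnegrE ?mulr_ge0 ?exprn_ge0 //; try lra.
    by have := bern (2 ^ n)%N; rewrite natrX; lra.
  have p0 : 0 < 2 ^+ n :> R by rewrite exprn_gt0.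
  rewrite -(ler_pM2l p0); move: h2; rewrite (exprS _ n).
  have -> : 2 ^+ n * (2 * c) = c * (2 * 2 ^+ n) by ring.
  move: (2 ^+ n) => u h2.
  have -> : u * (u * d ^+ 2) = (u * d) ^+ 2 by ring.
  exact: h2.
have [N _ /(_ N (leqnn N)) hN] : exists2 N, True & forall k, (N <= k)%N -> 2 * c / d ^+ 2 < k%:R :> R.
  exists (Num.trunc (2 * c / d ^+ 2)).+1 => // k hk.
  case: (lerP 0 (2 * c / d ^+ 2)) => [p|p].
    apply: lt_le_trans (truncnS_gt _) _; by rewrite ler_nat.
  by apply: lt_le_trans p _.
have := key N; rewrite -ler_pdivlMr ?exprn_gt0 // leNgt => /negP; apply.
apply: lt_le_trans hN _; rewrite -natrX ler_nat.
by apply: ltnW; apply: ltn_expl.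
Qed.

(** * Quasi-unitaries and the automatic continuity of *-homomorphisms *)

Section Limits.
Variable R : realType.
Local Notation C := R[i].
Variable A : cstarAlgType R.
Implicit Types (x y z h : A).

Local Notation "x ** y" := (@cmul R A x y) (at level 40, left associativity).
Local Notation "x ^#" := (@cadj R A x) (at level 2, format "x ^#").

Lemma geometric_eq0 x (K : R) : (forall n, nrm x <= K * 2^-1 ^+ n) -> x = 0.
Proof.
move=> xK; apply: nrm_eq0; apply/le_anti; rewrite nrm_ge0 andbT leNgt.
apply/negP => x0.
have K0 : 0 <= K by have := xK 0%N; rewrite expr0 mulr1; apply: le_trans; apply: ltW.
have /= := truncnS_gt (K / nrm x); set N := (Num.trunc _).+1 => hN.
have := xK N; rewrite exprVn ler_pdivlMr ?exprn_gt0 // leNgt => /negP; apply.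
rewrite mulrC -ltr_pdivrMr //; apply: lt_le_trans hN _.
by rewrite -natrX ler_nat ltnW // ltn_expl.
Qed.

Lemma geometric_cvg (u : nat -> A) (K : R) :
  (forall n, nrm (u n.+1 - u n) <= K * 2^-1 ^+ n) ->
  exists l, (forall n, nrm (u n - l) <= 2 * K * 2^-1 ^+ n) /\
    (forall S : set A, closed S -> (forall n, S (u n)) -> S l).
Proof.
move=> uK.
have K0 : 0 <= K.
  by have := uK 0%N; rewrite expr0 mulr1; apply: le_trans; exact: nrm_ge0.
have dist n k : nrm (u (n + k)%N - u n) <= 2 * K * 2^-1 ^+ n * (1 - 2^-1 ^+ k).
  elim: k => [|k IH]; first by rewrite addn0 subrr nrm0 expr0 subrr mulr0.
  have -> : u (n + k.+1)%N - u n = (u (n + k).+1 - u (n + k)%N) + (u (n + k)%N - u n).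
    by rewrite addnS addrA subrK.
  apply: le_trans (nrmD _ _) _; apply: le_trans (lerD (uK _) IH) _.
  rewrite exprD exprS; move: (2^-1 ^+ n) (2^-1 ^+ k) => a b.
  by rewrite le_eqVlt; apply/orP; left; apply/eqP; field.
have {}dist n k : (n <= k)%N -> nrm (u k - u n) <= 2 * K * 2^-1 ^+ n.
  move=> /subnKC <-; apply: le_trans (dist _ _) _.
  have p0 j : 0 <= 2^-1 ^+ j :> R by rewrite exprn_ge0 // invr_ge0.
  rewrite -[leRHS]mulr1; apply: ler_wpM2l; first by rewrite !mulr_ge0.
  by rewrite lerBlDr lerDl.
have cu : cvg (u @ \oo).
  apply/cauchy_cvgP; apply: cauchy_exP => e e0.
  have eE : e = (complex.Re e)%:C%C by rewrite RRe_real // gtr0_real.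
  have {e0} : 0 < complex.Re e by rewrite -ltcR -eE.
  move: (complex.Re e) eE => r {e}-> r0.
  have /= := truncnS_gt (2 * K / r); set N := (Num.trunc _).+1 => hN.
  exists (u N); exists N => // k /= Nk.
  rewrite -ball_normE /ball_ /= nrmE ltcR nrmBC.
  apply: le_lt_trans (dist _ _ Nk) _.
  rewrite exprVn ltr_pdivrMr ?exprn_gt0 // -ltr_pdivrMl // mulrC.
  apply: lt_trans hN _; by rewrite -natrX ltr_nat ltn_expl.
exists (lim (u @ \oo)); split => [n|S clS uS]; last first.
  by apply: (closed_cvg S clS _ _ cu); near=> k; exact: uS.
apply/ler_addgt0Pr => e e0.
have ec0 : 0 < e%:C%C by rewrite ltcR.
have [N _ /(_ (maxn n N)) /=] := (@cvgrPdist_lt _ _ _ _ _ _ _).1 cu _ ec0.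
rewrite leq_maxr nrmE ltcR => /(_ isT) h.
have -> : u n - lim (u @ \oo) = (u n - u (maxn n N)) - (lim (u @ \oo) - u (maxn n N)).
  by rewrite opprB addrA subrK.
apply: le_trans (nrmB _ _) _; apply: lerD; last exact: ltW.
by rewrite nrmBC dist // leq_maxl.
Unshelve. all: by end_near.
Qed.

(** A square root of 1 - h^2 for a small self-adjoint h, written as 1 - s since
    there need not be a unit: (1 - s)^2 = 1 - h^2 reads h^2 + s^2 = 2 s, and s
    is found as the fixed point of the contraction s |-> (h^2 + s^2) / 2. *)
Lemma quasi_sqrt (S : set A) h : cstar_subalgebra S -> S h -> h^# = h ->
  nrm h <= 2^-1 -> exists s, [/\ S s, s^# = s, h ** s = s ** h &
    h ** h + s ** s = s + s].
Proof.
move=> [S0 SL SM Sa Sc] Sh hh h2.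
have SZ (a : C) x : S x -> S (a *: x).
  by move=> Sx; rewrite -[_ *: _]addr0; apply: SL.
have SD x y : S x -> S y -> S (x + y).
  by move=> Sx Sy; rewrite -[x]scale1r; apply: SL.
pose f s : A := (2^-1 : C) *: (h ** h + s ** s).
pose u n := iter n f 0.
have half : cnrm (2^-1 : C) = 2^-1 :> R.
  by rewrite -(@cnrmR R 2^-1) ?invr_ge0 // fmorphV rmorph_nat.
have Su n : S (u n) by elim: n => //= n IH; apply/SZ/SD; apply: SM.
have ua n : (u n)^# = u n.
  elim: n => [|n IH] /=; first exact: cadj0.
  by rewrite cadjZ cadjD !cadjM hh IH fmorphV rmorph_nat.
have uc n : h ** u n = u n ** h.
  elim: n => [|n IH] /=; first by rewrite cmul0l cmul0r.
  rewrite cmulZr cmulZl cmulDl cmulDr -!cmulA; congr (_ *: (_ + _)).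
  by rewrite -IH !cmulA IH.
have un n : nrm (u n) <= 2^-1.
  elim: n => [|n IH] /=; first by rewrite nrm0 invr_ge0.
  rewrite nrmZ half; have := nrmD (h ** h) (u n ** u n).
  have := nrmM h h; have := nrmM (u n) (u n).
  have := nrm_ge0 h; have := nrm_ge0 (u n).
  by rewrite -/(u n); nra.
have ud n : nrm (u n.+1 - u n) <= 1 * 2^-1 ^+ n.
  elim: n => [|n IH].
    by rewrite subr0 expr0 mulr1; apply: le_trans (un 1%N) _; lra.
  have -> : u n.+2 - u n.+1 =
      (2^-1 : C) *: (u n.+1 ** (u n.+1 - u n) + (u n.+1 - u n) ** u n).
    rewrite {1}/u /= -/(u n.+1) {2}/u /= -/(u n) -scalerBr; congr (_ *: _).
    rewrite cmulBl cmulBr; linear_ring.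
  rewrite nrmZ half exprS mulrA [1 * _]mulrC -mulrA ler_pM2l ?invr_gt0 //.
  apply: le_trans (nrmD _ _) _; apply: le_trans (lerD (nrmM _ _) (nrmM _ _)) _.
  apply: le_trans IH; have := un n; have := un n.+1.
  by have := nrm_ge0 (u n.+1 - u n); nra.
have [l [lu lS]] := geometric_cvg ud.
have lub n : nrm (u n - l) <= 2 * 2^-1 ^+ n by have := lu n; rewrite mulr1.
have nl : nrm l <= 3.
  have -> : l = u 0%N - (u 0%N - l) by rewrite opprB addrC subrK.
  apply: le_trans (nrmB _ _) _; have := lub 0%N; have := un 0%N.
  by rewrite expr0; lra.
exists l; split.
- exact: lS.
- apply/eqP; rewrite -subr_eq0; apply/eqP; apply: (@geometric_eq0 _ 4) => n.
  have -> : l^# - l = (u n - l) - (u n - l)^#.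
    by rewrite cadjB ua; linear_ring.
  by apply: le_trans (nrmB _ _) _; rewrite nrm_adj; have := lub n; lra.
- apply/eqP; rewrite -subr_eq0; apply/eqP; apply: (@geometric_eq0 _ 4) => n.
  have -> : h ** l - l ** h = (u n - l) ** h - h ** (u n - l).
    by rewrite cmulBl cmulBr uc; linear_ring.
  apply: le_trans (nrmB _ _) _; apply: le_trans (lerD (nrmM _ _) (nrmM _ _)) _.
  by have := lub n; have := nrm_ge0 (u n - l); nra.
- apply/eqP; rewrite -subr_eq0; apply/eqP; apply: (@geometric_eq0 _ 12) => n.
  have un1 : u n.+1 + u n.+1 = h ** h + u n ** u n.
    by rewrite -scalerDl (_ : 2^-1 + 2^-1 = 1 :> C) ?scale1r //; field.
  have -> : h ** h + l ** l - (l + l) = (u n.+1 - l) + (u n.+1 - l)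
      - ((u n - l) ** u n + l ** (u n - l)).
    have -> : h ** h = u n.+1 + u n.+1 - u n ** u n by rewrite un1 addrK.
    by rewrite cmulBl cmulBr; linear_ring.
  apply: le_trans (nrmB _ _) _; apply: le_trans (lerD (nrmD _ _) (nrmD _ _)) _.
  have := lub n; have := lub n.+1; rewrite exprS.
  have := nrmM (u n - l) (u n); have := nrmM l (u n - l); have := un n.
  have := nrm_ge0 (u n - l).
  by move: (2^-1 ^+ n) => e; nra.
Qed.

Lemma quasi_unitary_adj h s : h^# = h -> s^# = s ->
  ('i%R *: h + (- 1 : C) *: s)^# = (- 1 : C) *: s - 'i%R *: h.
Proof.
by move=> hh sa; rewrite cadjD !cadjZ hh sa conjCi rmorphN1; linear_ring.
Qed.

(** With s the quasi square root of h, the element w = - s + i h makes 1 + w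
    unitary: it is the point of the unit circle above h. *)
Lemma quasi_unitary_eq h s (w := 'i%R *: h + (- 1 : C) *: s) :
  h^# = h -> s^# = s -> h ** s = s ** h -> h ** h + s ** s = s + s ->
  w + w^# + w^# ** w = 0.
Proof.
move=> hh sa hs hss.
rewrite /w quasi_unitary_adj // !(cmulDl, cmulDr, cmulNl, cmulZl, cmulZr) hs.
have -> : s ** s = s + s - h ** h by rewrite -hss addrC addKr.
rewrite (scalerA _ _ (h ** h)) -[_ * 'i]expr2 sqrCi.
by linear_ring.
Qed.

End Limits.

Section Contractive.
Variable R : realType.
Local Notation C := R[i].
Variables (A D : cstarAlgType R) (S : set A) (f : A -> D).
Hypotheses (hS : cstar_subalgebra S) (hf : star_hom_on S f).

Lemma sub_lin (a : C) x y : S x -> S y -> S (a *: x + y).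
Proof. by case: hS => _ h _ _ _; exact: h. Qed.
Lemma subZ (a : C) x : S x -> S (a *: x).
Proof.
by move=> Sx; rewrite -[_ *: _]addr0; apply: sub_lin => //; case: hS.
Qed.
Lemma subD x y : S x -> S y -> S (x + y).
Proof. by move=> Sx Sy; rewrite -[x]scale1r; apply: sub_lin. Qed.
Lemma sub_mul x y : S x -> S y -> S (cmul x y).
Proof. by case: hS => _ _ h _ _; exact: h. Qed.
Lemma sub_adj x : S x -> S (cadj x).
Proof. by case: hS => _ _ _ h _; exact: h. Qed.
Lemma hom0 : f 0 = 0.
Proof.
case: hf => lin _ _; case: hS => S0 _ _ _ _.
have := lin 1 0 0 S0 S0; rewrite !scale1r addr0 => /esym/eqP.
by rewrite -subr_eq0 addrK => /eqP.
Qed.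
Lemma homZ (a : C) x : S x -> f (a *: x) = a *: f x.
Proof.
move=> Sx; case: hf => lin _ _; case: hS => S0 _ _ _ _.
by have := lin a x 0 Sx S0; rewrite addr0 hom0 addr0.
Qed.
Lemma homD x y : S x -> S y -> f (x + y) = f x + f y.
Proof.
by move=> Sx Sy; case: hf => lin _ _; have := lin 1 x y Sx Sy; rewrite !scale1r.
Qed.
Lemma hom_sqn n x : S x -> S (sqn n x) /\ f (sqn n x) = sqn n (f x).
Proof.
move=> Sx; case: hf => _ fM _.
elim: n => //= n [Sn <-]; split; first exact: sub_mul.
exact: fM.
Qed.

(** For a small self-adjoint h, the element w = - s + i h, with s the quasi
    square root of h, satisfies w + w^* + w^* w = 0, which says that 1 + w is an
    isometry.  The relation is preserved by f, and in any C*-algebra it forces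
    the norm of w to be at most 2, by the C*-identity. *)
Lemma hom_bounded_small h : S h -> cadj h = h -> nrm h <= 2^-1 ->
  nrm (f h) <= 2.
Proof.
move=> Sh hh h2; case: (hf) => lin fM fa.
have [s [Ss sa hs hss]] := quasi_sqrt hS Sh hh h2.
pose w := 'i%R *: h + (- 1 : C) *: s.
have Sw : S w by apply: sub_lin => //; exact: subZ.
have wa := quasi_unitary_adj hh sa.
have wq := quasi_unitary_eq hh sa hs hss.
rewrite -/w in wa wq.
have fwa : f (cadj w) = cadj (f w) by exact: fa.
have fwq : cmul (cadj (f w)) (f w) = - (f w + cadj (f w)).
  rewrite -fwa -fM //; last exact: sub_adj.
  apply/eqP; rewrite -addr_eq0 addrC -homD //; last exact: sub_adj.
  rewrite -homD ?wq ?hom0 //; last by apply: sub_mul => //; exact: sub_adj.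
  by apply: subD => //; exact: sub_adj.
have w2 : nrm (f w) <= 2.
  have := nrm_adjM (f w); rewrite fwq nrmN => e.
  have := nrmD (f w) (cadj (f w)); rewrite nrm_adj e.
  by have := nrm_ge0 (f w); nra.
have fhi : f h = (- 'i / 2) *: (f w - cadj (f w)).
  rewrite -fwa wa -scaleNr !lin ?homZ //; try exact: subZ.
  have -> : 'i *: f h + (- 1) *: f s - ((- 1) *: f s + (- 'i) *: f h)
      = ('i + 'i) *: f h by linear_ring.
  rewrite scalerA mulrDr -mulrDl -splitr mulNr -expr2 sqrCi opprK.
  by rewrite scale1r.
rewrite fhi nrmZ.
have -> : cnrm (- 'i / 2 : C) = 2^-1 :> R.
  rewrite -(@cnrmR R 2^-1) ?invr_ge0 //; congr complex.Re.
  by rewrite normrM normrN normCi mul1r fmorphV rmorph_nat.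
have := nrmB (f w) (cadj (f w)); rewrite nrm_adj; lra.
Qed.

Lemma hom_bounded_sa h : S h -> cadj h = h -> nrm (f h) <= 4 * nrm h.
Proof.
move=> Sh hh; case: (ltgtP (nrm h) 0) => [|h0|h0]; first by rewrite ltNge nrm_ge0.
  pose r := (2 * nrm h)^-1.
  have r0 : 0 < r by rewrite invr_gt0 mulr_gt0.
  have rh : nrm (r%:C%C *: h) <= 2^-1.
    by rewrite nrmZ (cnrmR (ltW r0)) /r invfM -mulrA mulVf ?gt_eqF // mulr1.
  have := hom_bounded_small (subZ r%:C%C Sh) _ rh.
  rewrite cadjZ hh conj_Creal ?complex_real // => /(_ erefl).
  rewrite homZ // nrmZ (cnrmR (ltW r0)) /r ler_pdivrMl ?mulr_gt0 //; lra.
by rewrite (nrm_eq0 h0) hom0 !nrm0 mulr0.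
Qed.

Theorem hom_contractive x : S x -> nrm (f x) <= nrm x.
Proof.
move=> Sx; case: (hf) => _ fM fa.
pose h := cmul (cadj x) x.
have Sh : S h by apply: sub_mul => //; exact: sub_adj.
have hh : cadj h = h by rewrite cadjM cadjK.
have fhh : cadj (f h) = f h by rewrite -fa // hh.
have : nrm (f h) <= nrm h.
  apply: (@le_of_powers R _ _ 4); try exact: nrm_ge0.
  move=> n; rewrite -!nrm_sqn //; have [Sn <-] := hom_sqn n Sh.
  have e : cadj (sqn n h) = sqn n h by rewrite sqn_adj hh.
  apply: le_trans (hom_bounded_sa Sn e) _.
  rewrite ler_wpM2r ?nrm_ge0 // ler_peMr // -natrX ler1n expn_gt0 //.
rewrite fM ?fa ?nrm_adjM //; last exact: sub_adj.
by rewrite ler_pXn2r // nnegrE nrm_ge0.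
Qed.

End Contractive.

(** * Sums of squares *)

Section Positivity.
Variable R : realType.
Local Notation C := R[i].
Variable A : cstarAlgType R.
Implicit Types (x y z h k u : A) (r s e : R).

Local Notation "x ** y" := (@cmul R A x y) (at level 40, left associativity).
Local Notation "x ^#" := (@cadj R A x) (at level 2, format "x ^#").
Local Notation "r *:: x" := ((r%:C)%C *: x : A) (at level 40).

Lemma cstar_subalgebraT : cstar_subalgebra (setT : set A).
Proof. by split => //; exact: closedT. Qed.

Lemma nrmZR r x : 0 <= r -> nrm (r *:: x) = r * nrm x.
Proof. by move=> r0; rewrite nrmZ cnrmR. Qed.
Lemma cadjZR r x : (r *:: x)^# = r *:: x^#.
Proof. by rewrite cadjZ conj_Creal // complex_real. Qed.

(** For a self-adjoint h this says that the spectrum of h lies in [0, 2 s]; in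
    this form the condition is visibly stable under sums. *)
Definition pos h := exists2 s, 0 < s & forall y, nrm (s *:: y - h ** y) <= s * nrm y.

Lemma posD h k : pos h -> pos k -> pos (h + k).
Proof.
move=> [r r0 hr] [s s0 ks]; exists (r + s); first exact: addr_gt0.
move=> y; rewrite cmulDl rmorphD /= mulrDl.
have -> : (r%:C + s%:C)%C *: y - (h ** y + k ** y)
   = (r *:: y - h ** y) + (s *:: y - k ** y) by linear_ring.
exact: le_trans (nrmD _ _) (lerD (hr y) (ks y)).
Qed.

Lemma posZ r h : 0 < r -> pos h -> pos (r *:: h).
Proof.
move=> r0 [s s0 hs]; exists (r * s); first exact: mulr_gt0.
move=> y; rewrite cmulZl rmorphM /= -scalerA -scalerBr nrmZR ?(ltW r0) //.
by rewrite -mulrA ler_pM2l.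
Qed.

Lemma pos_lower h e y : pos h -> 0 <= e ->
  e * nrm y <= nrm (e *:: y + h ** y).
Proof.
move=> [s s0 hs] e0; have := nrmD (e *:: y + h ** y) (s *:: y - h ** y).
have -> : e *:: y + h ** y + (s *:: y - h ** y) = (e + s) *:: y.
  by rewrite rmorphD /=; linear_ring.
rewrite nrmZR; last by rewrite addr_ge0 // ltW.
by have := hs y; lra.
Qed.

Lemma quasi_unitary_nrm w y : w + w^# + w^# ** w = 0 -> nrm (y + w ** y) = nrm y.
Proof.
move=> hw; have e : (y + w ** y)^# ** (y + w ** y) = y^# ** y.
  rewrite cadjD cadjM cmulDl !cmulDr -!cmulA.
  have -> : y^# ** y + y^# ** (w ** y) + (y^# ** (w^# ** y) + y^# ** (w^# ** (w ** y)))
    = y^# ** y + y^# ** ((w + w^# + w^# ** w) ** y).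
    by rewrite !cmulDl !cmulDr -!cmulA; linear_ring.
  by rewrite hw cmul0l cmul0r addr0.
apply/eqP; rewrite -(@eqrXn2 _ 2) ?nrm_ge0 //.
by rewrite -!nrm_adjM e.
Qed.

(** With s the quasi square root of k, 1 - k^2 is the square of 1 - s, which is
    the real part of a unitary. *)
Lemma pos_sqr k : k^# = k -> pos (k ** k).
Proof.
move=> kk; pose c := (2 * (nrm k + 1))^-1.
have n0 := nrm_ge0 k.
have c0 : 0 < c by rewrite invr_gt0 mulr_gt0 //; lra.
have ch : (c *:: k)^# = c *:: k by rewrite cadjZR kk.
have cn : nrm (c *:: k) <= 2^-1.
  rewrite nrmZR ?(ltW c0) // /c ler_pdivrMl ?mulr_gt0 //; lra.
have [s [_ sa hs hss]] := quasi_sqrt cstar_subalgebraT I ch cn.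
move: ch cn hs hss; set h := c *:: k => ch cn hs hss.
have hE : h = c *:: k by [].
clearbody h.
have contr y : nrm (y - s ** y) <= nrm y.
  have w1 := quasi_unitary_nrm y (quasi_unitary_eq ch sa hs hss).
  have w2 : nrm (y + ('i%R *: (- h) + (- 1 : C) *: s) ** y) = nrm y.
    apply: quasi_unitary_nrm; apply: quasi_unitary_eq => //.
    - by rewrite cadjN ch.
    - by rewrite cmulNl cmulNr hs.
    - by rewrite cmulNl cmulNr opprK.
  have -> : y - s ** y = 2^-1 *:: ((y + ('i%R *: h + (- 1 : C) *: s) ** y)
       + (y + ('i%R *: (- h) + (- 1 : C) *: s) ** y)).
    rewrite !cmulDl !cmulZl cmulNl.
    rewrite [RHS](_ : _ = (2^-1 * 2)%:C%C *: (y - s ** y)).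
      by rewrite mulVf ?scale1r // pnatr_eq0.
    by rewrite rmorphM /= rmorph_nat; linear_ring.
  rewrite nrmZR ?invr_ge0 //.
  have := nrmD (y + ('i%R *: h + (- 1 : C) *: s) ** y)
     (y + ('i%R *: (- h) + (- 1 : C) *: s) ** y).
  by rewrite w1 w2; lra.
have hpos : pos (h ** h).
  exists 1 => // y; rewrite scale1r mul1r.
  have -> : y - (h ** h) ** y = (y - s ** y) - s ** (y - s ** y).
    have -> : h ** h = s + s - s ** s by rewrite -hss addrK.
    by rewrite !(cmulDl, cmulBr, cmulNl) -!cmulA; linear_ring.
  exact: le_trans (contr _) (contr _).
have -> : k ** k = (c^-1 * c^-1) *:: (h ** h).
  rewrite hE cmulZl cmulZr !scalerA -!rmorphM /=.
  rewrite (_ : _ * (c * c) = 1); last by field; rewrite gt_eqF.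
  by rewrite scale1r.
by apply: posZ => //; rewrite mulr_gt0 // invr_gt0.
Qed.

Lemma adjM_eq0 u : u^# ** u = 0 -> u = 0.
Proof.
move=> uu; apply: nrm_eq0; have := nrm_adjM u; rewrite uu nrm0 => /esym/eqP.
by rewrite sqrf_eq0 => /eqP.
Qed.

Lemma sqr_eq0 k : k^# = k -> k ** k = 0 -> k = 0.
Proof. by move=> kk e; apply: adjM_eq0; rewrite kk. Qed.

Lemma adjM_sa u : (u^# ** u)^# = u^# ** u. Proof. by rewrite cadjM cadjK. Qed.

(** If m = - u^* u is positive then so is n = u u^*, since n - m is a sum of
    squares of self-adjoint elements.  Now (1 + n)^(2^i) - 1 grows at least like
    2^i on the range of u, whereas u intertwines it with (1 - m)^(2^i) - 1, which
    stays bounded. *)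
Lemma neg_adjM_eq0 u : pos (- (u^# ** u)) -> u = 0.
Proof.
move=> Pm; have Pn : pos (u ** u^#).
  pose b := 'i%R *: (u - u^#).
  have bb : b^# = b.
    by rewrite /b cadjZ cadjB cadjK conjCi; linear_ring.
  have aa : (u + u^#)^# = u + u^# by rewrite cadjD cadjK addrC.
  have -> : u ** u^# = 2^-1 *:: ((u + u^#) ** (u + u^#) + b ** b
      + (- (u^# ** u) - u^# ** u)).
    rewrite /b !(cmulZl, cmulZr) scalerA -expr2 sqrCi.
    rewrite !(cmulBl, cmulBr, cmulDl, cmulDr).
    rewrite [RHS](_ : _ = (2^-1 * 2)%:C%C *: (u ** u^#)).
      by rewrite mulVf ?scale1r // pnatr_eq0.
    by rewrite rmorphM /= rmorph_nat; linear_ring.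
  apply: posZ; first by rewrite invr_gt0.
  by apply: posD; apply: posD => //; exact: pos_sqr.
case: Pm => s s0 ms.
pose step k : A := k + k + k ** k.
pose m i := iter i step (s^-1 *:: (u^# ** u)).
pose n i := iter i step (s^-1 *:: (u ** u^#)).
have step_sa k : k^# = k -> (step k)^# = step k.
  by move=> kk; rewrite /step !cadjD cadjM kk.
have m_sa i : (m i)^# = m i.
  by elim: i => [|i IH] /=; [rewrite cadjZR adjM_sa|exact: step_sa].
have n_sa i : (n i)^# = n i.
  elim: i => [|i IH] /=; last exact: step_sa.
  by rewrite cadjZR cadjM cadjK.
have n_pos i : pos (n i).
  elim: i => [|i IH] /=; first by apply: posZ => //; rewrite invr_gt0.
  by rewrite /step; apply: posD; [exact: posD|apply: pos_sqr].
have um i : u ** m i = n i ** u.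
  elim: i => [|i IH] /=; first by rewrite cmulZl cmulZr cmulA.
  by rewrite /step !(cmulDl, cmulDr) cmulA IH -cmulA IH cmulA.
have m_contr i y : nrm (y + m i ** y) <= nrm y.
  elim: i y => [|i IH] y /=.
    have -> : y + (s^-1 *:: (u^# ** u)) ** y
        = s^-1 *:: (s *:: y - (- (u^# ** u)) ** y).
      rewrite cmulNl opprK scalerDr scalerA -rmorphM /= mulVf ?gt_eqF //.
      by rewrite scale1r cmulZl.
    rewrite nrmZR ?invr_ge0 ?(ltW s0) // ler_pdivrMl //; exact: ms.
  have -> : y + step (m i) ** y = (y + m i ** y) + m i ** (y + m i ** y).
    by rewrite /step !(cmulDl, cmulDr) cmulA; linear_ring.
  exact: le_trans (IH _) (IH _).
have nu_le i : nrm (n i ** u) <= 2 * nrm u.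
  rewrite -um -nrm_adj cadjM m_sa.
  have -> : m i ** u^# = (u^# + m i ** u^#) - u^# by linear_ring.
  apply: le_trans (nrmB _ _) _; rewrite nrm_adj.
  by have := m_contr i u^#; rewrite nrm_adj; lra.
have nu_ge i : 2 ^+ i * nrm (n 0%N ** u) <= nrm (n i ** u).
  elim: i => [|i IH]; first by rewrite expr0 mul1r.
  rewrite exprS -mulrA.
  apply: (@le_trans _ _ (2 * nrm (n i ** u))); first by rewrite ler_pM2l.
  apply: le_trans (pos_lower _ (n_pos i) _) _ => //.
  rewrite rmorph_nat /= /step !cmulDl cmulA.
  by rewrite (_ : 2 *: (n i ** u) = n i ** u + n i ** u) //; linear_ring.
have nu0 : n 0%N ** u = 0.
  apply: (@geometric_eq0 _ _ _ (2 * nrm u)) => i.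
  rewrite exprVn ler_pdivlMr ?exprn_gt0 // mulrC.
  exact: le_trans (nu_ge i) (nu_le i).
apply/adjM_eq0/(sqr_eq0 (adjM_sa u)).
have e : u ** u^# ** u = 0.
  have : s *:: (n 0%N ** u) = 0 by rewrite nu0 scaler0.
  by rewrite /n /= cmulZl scalerA -rmorphM /= mulfV ?gt_eqF // scale1r.
have -> : u^# ** u ** (u^# ** u) = u^# ** (u ** u^# ** u) by rewrite !cmulA.
by rewrite e cmul0r.
Qed.

(** With u = x y^*, the element - u^* u is the square of y y^*, hence positive. *)
Lemma sum_adjM_eq0 x y : x^# ** x + y^# ** y = 0 -> x = 0.
Proof.
move=> xy; have e : x^# ** x = - (y^# ** y) by apply/eqP; rewrite -addr_eq0 xy.
have yy : (y ** y^#)^# = y ** y^# by rewrite cadjM cadjK.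
have eu : - ((x ** y^#)^# ** (x ** y^#)) = (y ** y^#) ** (y ** y^#).
  rewrite cadjM cadjK cmulA -(cmulA y) e cmulNr cmulNl opprK.
  by rewrite !cmulA.
have u0 : x ** y^# = 0 by apply: neg_adjM_eq0; rewrite eu; exact: pos_sqr.
have y0 : y ** y^# = 0.
  by apply: sqr_eq0 => //; rewrite -eu u0 cmul0r oppr0.
have {}y0 : y = 0.
  by rewrite -[y]cadjK (@adjM_eq0 y^#) ?cadj0 // cadjK.
by apply: adjM_eq0; rewrite e y0 cmul0r oppr0.
Qed.

(** Compressing q - t t^* = c^* c by 1 - q gives two squares with sum zero. *)
Lemma cle_projection q t : projection q -> cle (t ** t^#) q -> q ** t = t.
Proof.
move=> [qq qa] [c hc].
have : t^# - t^# ** q = 0.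
  apply: (@sum_adjM_eq0 _ (c - c ** q)).
  have -> : (c - c ** q)^# ** (c - c ** q)
     = (c^# ** c - c^# ** c ** q) - (q ** (c^# ** c) - q ** (c^# ** c) ** q).
    by rewrite cadjB cadjM qa cmulBl !cmulBr !cmulA; linear_ring.
  rewrite -hc cadjB cadjM qa cadjK.
  by rewrite !(cmulBl, cmulBr) !cmulA !qq; linear_ring.
move=> /eqP; rewrite subr_eq0 => /eqP /(congr1 (@cadj R A)).
by rewrite cadjM cadjK qa => <-.
Qed.

End Positivity.

(** * Cuntz-Krieger families and the finite-dimensional pieces of the core *)

Lemma big_seq_pick (W : zmodType) (I : eqType) (s : seq I) (F : I -> W) i :
  uniq s -> i \in s -> (forall j, j != i -> F j = 0) -> \sum_(j <- s) F j = F i.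
Proof.
move=> us si F0; rewrite (bigD1_seq i) //= big1 ?addr0 //.
Qed.

Section Family.
Variable R : realType.
Local Notation C := R[i].
Variables (A : cstarAlgType R) (E : choiceType).
Variables (P : set A) (t : E -> A) (src : E -> A).
Implicit Types (x y z p r a b : A) (e f g : E) (l : seq A) (s : seq E).

Local Notation "x ** y" := (cmul x y) (at level 40, left associativity).
Local Notation "x ^#" := (cadj x) (at level 2, format "x ^#").

(** The relations satisfied by the projections and partial isometries of a
    representation: P is a Boolean ring of commuting projections, in which the
    projection of a source vertex is minimal (fam_vertex).  The last clause is
    the summation relation at a regular vertex; at a vertex with infinitely many
    edges it only records that no finite list exhausts them. *)
Record ck_family : Prop := {
  fam0 : P 0;
  fam_sa : forall p, P p -> p^# = p;
  fam_idem : forall p, P p -> p ** p = p;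
  famM : forall p r, P p -> P r -> P (p ** r);
  famB : forall p r, P p -> P r -> P (p - p ** r);
  famU : forall p r, P p -> P r -> P (p + r - p ** r);
  fam_range : forall e, P ((t e)^# ** t e);
  fam_pisom : forall e, t e ** ((t e)^# ** t e) = t e;
  fam_orth : forall e f, e != f -> (t e)^# ** t f = 0;
  fam_src : forall e, P (src e);
  fam_srcM : forall e, src e ** t e = t e;
  fam_vertex : forall p e, P p -> p ** src e = src e \/ p ** src e = 0;
  fam_regular : forall e,
    (forall s, exists2 g, g \notin s & src g = src e) \/
    (exists s, [/\ uniq s, forall f, f \in s -> src f = src e
       & src e = \sum_(f <- s) t f ** (t f)^#])
}.

Hypothesis fam : ck_family.

Lemma famC p r : P p -> P r -> p ** r = r ** p.
Proof.
move=> Pp Pr; rewrite -[LHS](fam_sa fam (famM fam Pp Pr)) cadjM.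
by rewrite !(fam_sa fam).
Qed.

Lemma proj_nrm1 z : z^# = z -> z ** z = z -> z != 0 -> nrm z = 1.
Proof.
move=> za zz z0; have := nrm_adjM z; rewrite za zz expr2 => e.
have : nrm z != 0 by apply: contra_neq z0; exact: nrm_eq0.
by move=> n0; apply: (mulfI n0); rewrite mulr1.
Qed.

Lemma proj_nrm_le1 z : z^# = z -> z ** z = z -> nrm z <= 1.
Proof.
move=> za zz; have [->|z0] := eqVneq z 0; first by rewrite nrm0.
by rewrite proj_nrm1.
Qed.

Lemma fam_proj_t p e : P p -> p ** t e = t e \/ p ** t e = 0.
Proof.
move=> Pp; rewrite -(fam_srcM fam e) cmulA.
by case: (fam_vertex fam e Pp) => ->; [left|right; rewrite cmul0l].
Qed.

Lemma t_nrm e : nrm (t e) <= 1.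
Proof.
rewrite -(@ler_pXn2r _ 2) ?nnegrE ?nrm_ge0 // expr1n -nrm_adjM.
by apply: proj_nrm_le1; [apply: (fam_sa fam)|apply: (fam_idem fam)];
  apply: fam_range.
Qed.

(** The algebra generated by b and the projections in l, for P commutative and
    b an upper bound of l, written along the binary tree that splits b by the
    successive elements of l.  The leaves are the atoms. *)
Fixpoint simple l b x : Prop :=
  if l is a :: l' then
    exists x1 x2, [/\ x = x1 + x2, simple l' (b ** a) x1
      & simple l' (b - b ** a) x2]
  else exists c : C, x = c *: b.

Lemma simple_lin l b (c : C) x y :
  simple l b x -> simple l b y -> simple l b (c *: x + y).
Proof.
elim: l b x y => [|a l IH] b x y /=.
  by move=> [d ->] [d' ->]; exists (c * d + d'); linear_ring.
move=> [x1 [x2 [-> Sx1 Sx2]]] [y1 [y2 [-> Sy1 Sy2]]].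
exists (c *: x1 + y1), (c *: x2 + y2); split; [|exact: IH|exact: IH].
by linear_ring.
Qed.

Lemma simple0 l b : simple l b 0.
Proof.
elim: l b => [|a l IH] b /=; first by exists 0; rewrite scale0r.
by exists 0, 0; rewrite addr0.
Qed.

Lemma simple_top l b : simple l b b.
Proof.
elim: l b => [|a l IH] b /=; first by exists 1; rewrite scale1r.
exists (b ** a), (b - b ** a); split => //.
by linear_ring.
Qed.

Lemma in_behead (a : A) l : {in a :: l, forall r, P r} -> {in l, forall r, P r}.
Proof. by move=> Pl r rl; apply: Pl; rewrite inE rl orbT. Qed.

Lemma simple_adj l b x : {in l, forall a, P a} -> P b ->
  simple l b x -> simple l b x^#.
Proof.
elim: l b x => [|a l IH] b x /= Pl Pb.
  by move=> [c ->]; exists (Num.conj c); rewrite cadjZ (fam_sa fam Pb).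
move=> [x1 [x2 [-> Sx1 Sx2]]].
have Pa : P a by apply: Pl; rewrite mem_head.
have Pl' := in_behead Pl.
exists x1^#, x2^#; rewrite cadjD; split => //.
  by apply: IH => //; exact: famM.
by apply: IH => //; exact: famB.
Qed.

Lemma simple_supp l b x : {in l, forall a, P a} -> P b ->
  simple l b x -> b ** x = x /\ x ** b = x.
Proof.
elim: l b x => [|a l IH] b x /= Pl Pb.
  by move=> [c ->]; rewrite cmulZl cmulZr (fam_idem fam Pb).
move=> [x1 [x2 [-> Sx1 Sx2]]].
have Pa : P a by apply: Pl; rewrite mem_head.
have Pl' := in_behead Pl.
have bb := fam_idem fam Pb.
have bab : b ** a ** b = b ** a by rewrite -cmulA (famC Pa Pb) cmulA bb.
have [h1 k1] := IH _ _ Pl' (famM fam Pb Pa) Sx1.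
have [h2 k2] := IH _ _ Pl' (famB fam Pb Pa) Sx2.
rewrite cmulDl cmulDr; split; congr (_ + _).
- by rewrite -h1 !cmulA bb.
- by rewrite -h2 cmulA cmulBr !cmulA bb.
- by rewrite -k1 -cmulA bab.
- by rewrite -k2 -cmulA cmulBl bab bb.
Qed.

Lemma simple_mul l b x y : {in l, forall a, P a} -> P b ->
  simple l b x -> simple l b y -> simple l b (x ** y).
Proof.
elim: l b x y => [|a l IH] b x y /= Pl Pb.
  move=> [c ->] [d ->]; exists (c * d).
  by rewrite cmulZl cmulZr (fam_idem fam Pb) scalerA.
move=> [x1 [x2 [-> Sx1 Sx2]]] [y1 [y2 [-> Sy1 Sy2]]].
have Pa : P a by apply: Pl; rewrite mem_head.
have Pl' := in_behead Pl.
have Pba := famM fam Pb Pa; have Pbb := famB fam Pb Pa.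
have ort : b ** a ** (b - b ** a) = 0.
  rewrite cmulBr -!cmulA (cmulA a) (famC Pa Pb) !cmulA (fam_idem fam Pb).
  by rewrite -(cmulA b a a) (fam_idem fam Pa) subrr.
exists (x1 ** y1), (x2 ** y2); split; [|exact: IH|exact: IH].
have [_ k1] := simple_supp Pl' Pba Sx1; have [h1 _] := simple_supp Pl' Pba Sy1.
have [_ k2] := simple_supp Pl' Pbb Sx2; have [h2 _] := simple_supp Pl' Pbb Sy2.
have e1 : x1 ** y2 = 0.
  by rewrite -k1 -h2 -cmulA (cmulA (b ** a)) ort cmul0l cmul0r.
have e2 : x2 ** y1 = 0.
  rewrite -k2 -h1 -cmulA (cmulA (b - _)) (famC Pbb Pba) ort.
  by rewrite cmul0l cmul0r.
by rewrite cmulDl !cmulDr e1 e2 addr0 add0r.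
Qed.

Lemma simple_gen l b a : {in l, forall r, P r} -> P b -> a \in l ->
  simple l b (b ** a).
Proof.
elim: l b => [//|r l IH] b /= Pl Pb; rewrite inE => /orP[/eqP ->|al].
  exists (b ** r), 0; rewrite addr0; split => //; first exact: simple_top.
  exact: simple0.
have Pr : P r by apply: Pl; rewrite mem_head.
have Pl' := in_behead Pl.
exists (b ** r ** a), ((b - b ** r) ** a); split; last 2 first.
- by apply: IH => //; exact: famM.
- by apply: IH => //; exact: famB.
- by rewrite cmulBl addrC subrK.
Qed.

Lemma simple_t l b x e : {in l, forall a, P a} -> P b ->
  simple l b x -> exists c : C, x ** t e = c *: t e.
Proof.
elim: l b x => [|a l IH] b x /= Pl Pb.
  move=> [c ->]; rewrite cmulZl.
  by case: (fam_proj_t e Pb) => ->; [exists c|exists 0; rewrite scaler0 scale0r].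
move=> [x1 [x2 [-> Sx1 Sx2]]].
have Pa : P a by apply: Pl; rewrite mem_head.
have Pl' := in_behead Pl.
have [c1 e1] := IH _ _ Pl' (famM fam Pb Pa) Sx1.
have [c2 e2] := IH _ _ Pl' (famB fam Pb Pa) Sx2.
by exists (c1 + c2); rewrite cmulDl e1 e2 scalerDl.
Qed.

Definition range_sum s : A := \sum_(e <- s) t e ** (t e)^#.

Lemma range_sum_t s e : uniq s -> e \in s -> range_sum s ** t e = t e.
Proof.
move=> us es; rewrite cmul_suml (big_seq_pick us es) => [|f fe].
  by rewrite -cmulA (fam_pisom fam).
by rewrite -cmulA (fam_orth fam) // cmul0r.
Qed.

Lemma range_sum_t0 s e : e \notin s -> range_sum s ** t e = 0.
Proof.
move=> es; rewrite cmul_suml big1_seq // => f /andP[_ fs].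
rewrite -cmulA (fam_orth fam) ?cmul0r //.
by apply: contraNneq es => <-.
Qed.

Lemma range_sum_sa s : (range_sum s)^# = range_sum s.
Proof.
by rewrite cadj_sum; apply: eq_bigr => e _; rewrite cadjM cadjK.
Qed.

Lemma range_sum_idem s : uniq s -> range_sum s ** range_sum s = range_sum s.
Proof.
move=> us; rewrite {2}/range_sum cmul_sumr; apply: eq_big_seq => e es.
by rewrite cmulA range_sum_t.
Qed.

Lemma range_sumC s p : P p -> p ** range_sum s = range_sum s ** p.
Proof.
move=> Pp; rewrite cmul_suml cmul_sumr; apply: eq_bigr => e _.
have -> : t e ** (t e)^# ** p = t e ** (p ** t e)^#.
  by rewrite cadjM (fam_sa fam Pp) cmulA.
rewrite cmulA.
by case: (fam_proj_t e Pp) => ->; rewrite ?cadj0 ?cmul0l ?cmul0r.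
Qed.

Lemma simple_range_sumC l b x s : {in l, forall a, P a} -> P b ->
  simple l b x -> x ** range_sum s = range_sum s ** x.
Proof.
elim: l b x => [|a l IH] b x /= Pl Pb.
  by move=> [c ->]; rewrite cmulZl cmulZr range_sumC.
move=> [x1 [x2 [-> Sx1 Sx2]]].
have Pa : P a by apply: Pl; rewrite mem_head.
have Pl' := in_behead Pl.
rewrite cmulDl cmulDr (IH _ _ Pl' (famM fam Pb Pa) Sx1).
by rewrite (IH _ _ Pl' (famB fam Pb Pa) Sx2).
Qed.

(** For a finite set s of edges, saturation makes 1 - range_sum s vanish at the
    regular sources of s, and at the other sources leaves an edge outside s. *)
Definition saturated_edges s := forall e, e \in s ->
  (exists2 g, g \notin s & src g = src e) \/ src e ** range_sum s = src e.

Lemma saturate s : exists s', [/\ uniq s', {subset s <= s'} & saturated_edges s'].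
Proof.
have [F FP] : exists F : E -> seq E, forall e,
    (forall s, exists2 g, g \notin s & src g = src e) /\ F e = [::] \/
    [/\ uniq (F e), forall f, f \in F e -> src f = src e
       & src e = \sum_(f <- F e) t f ** (t f)^#].
  suff /choice [F FP] : forall e, exists s1 : seq E,
    (forall s, exists2 g, g \notin s & src g = src e) /\ s1 = [::] \/
    [/\ uniq s1, forall f, f \in s1 -> src f = src e
       & src e = \sum_(f <- s1) t f ** (t f)^#] by exists F.
  move=> e; case: (fam_regular fam e) => [h|[s1 h]]; first by exists [::]; left.
  by exists s1; right.
pose s' := undup (s ++ flatten (map F s)).
have us' : uniq s' by rewrite undup_uniq.
have ss' : {subset s <= s'} by move=> e es; rewrite mem_undup mem_cat es.
have Fs' e f : e \in s -> f \in F e -> f \in s'.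
  move=> es fe; rewrite mem_undup mem_cat; apply/orP; right.
  by apply/flattenP; exists (F e) => //; exact: map_f.
exists s'; split => // e.
have reg e1 : e1 \in s -> (exists2 g, g \notin s' & src g = src e1)
    \/ src e1 ** range_sum s' = src e1.
  move=> es; case: (FP e1) => [[h _]|[uF Fe1 sum]]; [by left; exact: h|right].
  rewrite -{1}(fam_sa fam (fam_src fam e1)) -range_sum_sa -cadjM sum.
  rewrite cmul_sumr cadj_sum; apply: eq_big_seq => f fF.
  by rewrite cmulA range_sum_t ?cadjM ?cadjK //; exact: (Fs' e1).
rewrite mem_undup mem_cat => /orP[/reg//|/flattenP[s1 /mapP[e1 e1s ->] fe]].
case: (FP e1) => [[_ F0]|[uF Fe1 sum]]; first by move: fe; rewrite F0.
by rewrite (Fe1 e fe); exact: reg.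
Qed.

End Family.

(** * Isometry on the core *)

Section StarHom.
Variable R : realType.
Local Notation C := R[i].
Variables (A D : cstarAlgType R) (pi : A -> D).
Hypothesis hpi : star_hom pi.

Lemma starhomM x y : pi (cmul x y) = cmul (pi x) (pi y).
Proof. by case: hpi => _ h _; exact: h. Qed.
Lemma starhom_adj x : pi (cadj x) = cadj (pi x).
Proof. by case: hpi => _ _ h; exact: h. Qed.
Lemma starhom0 : pi 0 = 0.
Proof. exact: (hom0 (@cstar_subalgebraT R A) hpi). Qed.
Lemma starhomD x y : pi (x + y) = pi x + pi y.
Proof. exact: (homD hpi). Qed.
Lemma starhomZ (c : C) x : pi (c *: x) = c *: pi x.
Proof. exact: (homZ (@cstar_subalgebraT R A) hpi). Qed.
Lemma starhomN x : pi (- x) = - pi x.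
Proof. by rewrite -scaleN1r starhomZ scaleN1r. Qed.
Lemma starhomB x y : pi (x - y) = pi x - pi y.
Proof. by rewrite starhomD starhomN. Qed.
Lemma starhom_sqn n x : pi (sqn n x) = sqn n (pi x).
Proof. by have [] := hom_sqn (@cstar_subalgebraT R A) hpi n (I : setT x). Qed.
Lemma starhom_contr x : nrm (pi x) <= nrm x.
Proof. exact: (hom_contractive (@cstar_subalgebraT R A) hpi). Qed.

(** The C*-identity and the powers 2^n of x^* x turn an estimate with a constant
    of moderate growth into one with constant 1. *)
Lemma isometric_of_powers x (K : R) :
  (forall n, nrm (sqn n (cmul (cadj x) x))
     <= K * 2 ^+ n * nrm (pi (sqn n (cmul (cadj x) x)))) ->
  nrm x <= nrm (pi x).
Proof.
move=> hK; set h := cmul (cadj x) x in hK.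
have hh : cadj h = h by exact: adjM_sa.
have phh : cadj (pi h) = pi h by rewrite -starhom_adj hh.
have : nrm h <= nrm (pi h).
  apply: (@le_of_powers R _ _ K); try exact: nrm_ge0.
  by move=> n; rewrite -!nrm_sqn // -starhom_sqn.
rewrite /h starhomM starhom_adj !nrm_adjM.
by rewrite ler_pXn2r // nnegrE nrm_ge0.
Qed.

End StarHom.

Section Core.
Variable R : realType.
Local Notation C := R[i].
Variables (A D : cstarAlgType R) (E : choiceType).
Variables (P : set A) (t : E -> A) (src : E -> A).
Hypothesis fam : ck_family P t src.
Variable pi : A -> D.
Hypothesis hpi : star_hom pi.
Hypothesis pi_faithful : forall p, P p -> pi p = 0 -> p = 0.
Hypothesis t_neq0 : forall e, t e <> 0.
Implicit Types (x y z p r a b : A) (e f g : E) (l : seq A) (s : seq E).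

Local Notation "x ** y" := (cmul x y) (at level 40, left associativity).
Local Notation "x ^#" := (cadj x) (at level 2, format "x ^#").

Lemma pi_t_neq0 e : pi (t e) <> 0.
Proof.
move=> pt; apply: (@t_neq0 e); apply: adjM_eq0; apply: pi_faithful.
  exact: (fam_range fam).
by rewrite (starhomM hpi) pt cmul0r.
Qed.

(** Removing from p the sources of the edges in s does not change
    p - p range_sum s, by saturation: a source below p that is not covered by s has
    an edge outside s, on which p - p range_sum s acts as the identity. *)
Lemma range_sum_faithful s p : uniq s -> saturated_edges t src s -> P p ->
  pi (p - p ** range_sum t s) = 0 -> p - p ** range_sum t s = 0.
Proof.
move=> us ss Pp p0; set c := range_sum t s in p0 *.
suff [a [Pa ac az]] : exists a, [/\ P a, p - p ** c = a - a ** c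
    & forall e, e \in s -> a ** t e = 0].
  have ac0 : a ** c = 0.
    by rewrite cmul_sumr big1_seq // => e /andP[_ es]; rewrite cmulA az ?cmul0l.
  by move: p0; rewrite ac ac0 subr0; exact: pi_faithful.
suff : forall s1, {subset s1 <= s} -> exists a, [/\ P a, p - p ** c = a - a ** c
    & forall e, e \in s1 -> a ** t e = 0] by apply.
elim=> [|e s1 IH] s1s; first by exists p.
have [f fs1|a [Pa ac az]] := IH; first by apply: s1s; rewrite inE fs1 orbT.
have es : e \in s by apply: s1s; rewrite mem_head.
have Ps := fam_src fam e.
exists (a - a ** src e); split; first exact: (famB fam).
- rewrite ac; suff ec : a ** src e ** c = a ** src e by rewrite cmulBl ec; linear_ring.
  case: (fam_vertex fam e Pa) => ae; last by rewrite ae cmul0l.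
  rewrite ae; case: (ss e es) => [[g gs ge]|//].
  case: (@pi_t_neq0 g); suff -> : t g = (p - p ** c) ** t g.
    by rewrite (starhomM hpi) p0 cmul0l.
  rewrite ac cmulBl -cmulA (range_sum_t0 fam) // cmul0r subr0.
  by rewrite -(fam_srcM fam g) cmulA ge ae.
- move=> f; rewrite inE => /orP[/eqP ->|fs1].
    by rewrite cmulBl -cmulA (fam_srcM fam) subrr.
  by rewrite cmulBl (famC fam Pa Ps) -cmulA az // cmul0r subrr.
Qed.

Lemma pi_proj_nrm_le1 z : z^# = z -> z ** z = z -> nrm (pi z) <= 1.
Proof.
move=> za zz; apply: proj_nrm_le1; first by rewrite -(starhom_adj hpi) za.
by rewrite -(starhomM hpi) zz.
Qed.

(** The leaves of the tree are multiples of projections, on which pi is isometric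
    as soon as it does not annihilate them; each splitting costs a factor 2. *)
Lemma simple_range_sum_bound s l b x : uniq s -> saturated_edges t src s ->
  {in l, forall a, P a} -> P b -> simple l b x ->
  nrm (x - x ** range_sum t s) <= 2 ^+ size l * nrm (pi (x - x ** range_sum t s)).
Proof.
move=> us ss; set c := range_sum t s.
elim: l b x => [|a l IH] b x /= Pl Pb.
  move=> [k ->]; rewrite cmulZl -scalerBr (starhomZ hpi) !nrmZ expr0 mul1r.
  rewrite ler_wpM2l ?cnrm_ge0 //; set z := b - b ** c.
  have bb := fam_idem fam Pb; have bc := range_sumC fam s Pb.
  have za : z^# = z by rewrite /z cadjB cadjM (fam_sa fam Pb) range_sum_sa -bc.
  have zz : z ** z = z.
    rewrite /z !(cmulBl, cmulBr) !cmulA bb -(cmulA b (range_sum t s) b) -bc.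
    by rewrite !cmulA bb -(cmulA b _ (range_sum t s)) (range_sum_idem fam us) !subrr subr0.
  have [->|z0] := eqVneq z 0; first by rewrite nrm0 nrm_ge0.
  rewrite (proj_nrm1 za zz z0) proj_nrm1 //.
  - by rewrite -(starhom_adj hpi) za.
  - by rewrite -(starhomM hpi) zz.
  - by apply: contra_neq z0; exact: range_sum_faithful.
move=> [x1 [x2 [xE Sx1 Sx2]]].
have Pa : P a by apply: Pl; rewrite mem_head.
have Pl' := in_behead Pl.
have Pba := famM fam Pb Pa; have Pbb := famB fam Pb Pa.
have ort : b ** a ** (b - b ** a) = 0.
  rewrite cmulBr -!cmulA (cmulA a) (famC fam Pa Pb) !cmulA (fam_idem fam Pb).
  by rewrite -(cmulA b a a) (fam_idem fam Pa) subrr.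
have [h1 _] := simple_supp fam Pl' Pba Sx1.
have [h2 _] := simple_supp fam Pl' Pbb Sx2.
have piece p y : P p -> y = p ** x -> nrm (pi (y - y ** c)) <= nrm (pi (x - x ** c)).
  move=> Pp ->; rewrite -cmulA -cmulBr starhomM //.
  apply: le_trans (nrmM _ _) _; rewrite ler_piMl ?nrm_ge0 //.
  by apply: pi_proj_nrm_le1; [exact: (fam_sa fam)|exact: (fam_idem fam)].
have e1 : x1 = b ** a ** x.
  by rewrite xE cmulDr h1 -h2 cmulA ort cmul0l addr0.
have e2 : x2 = (b - b ** a) ** x.
  by rewrite xE cmulDr h2 -h1 cmulA (famC fam Pbb Pba) ort cmul0l add0r.
have -> : x - x ** c = (x1 - x1 ** c) + (x2 - x2 ** c).
  by rewrite xE cmulDl; linear_ring.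
have k1 := piece _ _ Pba e1; have k2 := piece _ _ Pbb e2.
apply: le_trans (nrmD _ _) _.
apply: le_trans (lerD (IH _ _ Pl' Pba Sx1) (IH _ _ Pl' Pbb Sx2)) _.
rewrite exprS -mulrA -mulrDr mulrCA ler_pM2l ?exprn_gt0 //.
have -> : x1 - x1 ** c + (x2 - x2 ** c) = x - x ** c.
  by rewrite xE cmulDl; linear_ring.
by move: k1 k2; lra.
Qed.

(** The finite data that determine one finite-dimensional piece of the core:
    edges in s, and projections in l below the projection b. *)
Record finite_data s l b : Prop := {
  fd_uniq : uniq s;
  fd_sat : saturated_edges t src s;
  fd_proj : {in l, forall a, P a};
  fd_top : P b;
  fd_le : {in l, forall a, b ** a = a};
  fd_range : {in s, forall e, (t e)^# ** t e \in l}
}.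

Definition block s (c : E -> E -> A) : A :=
  \sum_(e <- s) \sum_(f <- s) t e ** c e f ** (t f)^#.

(** Combinations of the t_mu p t_nu^* with mu, nu paths in s of equal length at
    most n.  Grouping them by the first edges of mu and nu makes the multiplicative
    structure visible: beyond the projections, this is the algebra of matrices
    over the piece of level n. *)
Fixpoint core s l b n x : Prop :=
  if n is n'.+1 then
    exists x0 c, [/\ simple l b x0,
      forall e f, e \in s -> f \in s -> core s l b n' (c e f) & x = x0 + block s c]
  else simple l b x.

Section Piece.
Variables (s : seq E) (l : seq A) (b : A).
Hypothesis fd : finite_data s l b.
Let Pl := fd_proj fd.
Let Pb := fd_top fd.
Let us := fd_uniq fd.

Lemma block_lin (k : C) c d : block s (fun e f => k *: c e f + d e f)
  = k *: block s c + block s d.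
Proof.
rewrite /block scaler_sumr -big_split; apply: eq_bigr => e _ /=.
rewrite scaler_sumr -big_split; apply: eq_bigr => f _ /=.
by rewrite cmulDr cmulDl cmulZr cmulZl.
Qed.

Lemma block_adj c : (block s c)^# = block s (fun e f => (c f e)^#).
Proof.
rewrite /block cadj_sum [RHS]exchange_big; apply: eq_bigr => e _ /=.
rewrite cadj_sum; apply: eq_bigr => f _.
by rewrite !cadjM cadjK cmulA.
Qed.

Lemma block0 c : (forall e f, c e f = 0) -> block s c = 0.
Proof.
move=> c0; rewrite /block big1 // => e _; rewrite big1 // => f _.
by rewrite c0 cmul0r cmul0l.
Qed.

Lemma block_tl c e : e \in s ->
  (t e)^# ** block s c = \sum_(f <- s) (t e)^# ** t e ** c e f ** (t f)^#.
Proof.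
move=> es; rewrite cmul_sumr (big_seq_pick us es) => [|g ge].
  by rewrite cmul_sumr; apply: eq_bigr => f _; rewrite !cmulA.
rewrite cmul_sumr big1 // => f _; rewrite !cmulA (fam_orth fam) 1?eq_sym //.
by rewrite !cmul0l.
Qed.

Lemma block_corner c e f : e \in s -> f \in s ->
  (t e)^# ** block s c ** t f = (t e)^# ** t e ** c e f ** ((t f)^# ** t f).
Proof.
move=> es fs; rewrite block_tl // cmul_suml (big_seq_pick us fs) => [|g gf].
  by rewrite !cmulA.
by rewrite -!cmulA (fam_orth fam) // !cmul0r.
Qed.

Lemma range_sum_block c : range_sum t s ** block s c = block s c.
Proof.
rewrite /block cmul_sumr; apply: eq_big_seq => e es.
rewrite cmul_sumr; apply: eq_bigr => f _.
by rewrite !cmulA (range_sum_t fam).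
Qed.

Lemma block_range_sum c : block s c ** range_sum t s = block s c.
Proof.
by rewrite -[LHS]cadjK cadjM range_sum_sa block_adj range_sum_block -block_adj cadjK.
Qed.

Lemma compression x : range_sum t s ** x ** range_sum t s
  = block s (fun e f => (t e)^# ** x ** t f).
Proof.
rewrite /range_sum !cmul_suml; apply: eq_bigr => e _.
by rewrite cmul_sumr; apply: eq_bigr => f _; rewrite !cmulA.
Qed.

Lemma simple_core n x : simple l b x -> core s l b n x.
Proof.
elim: n x => [|n IH] x //= Sx.
exists x, (fun _ _ => 0); split => //; last by rewrite block0 ?addr0.
by move=> _ _ _ _; apply: IH; exact: simple0.
Qed.

Lemma core_lin n (k : C) x y : core s l b n x -> core s l b n y ->
  core s l b n (k *: x + y).
Proof.
elim: n x y => [|n IH] x y /=; first exact: simple_lin.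
move=> [x0 [c [Sx Cc ->]]] [y0 [d [Sy Cd ->]]].
exists (k *: x0 + y0), (fun e f => k *: c e f + d e f); split.
- exact: simple_lin.
- by move=> e f es fs; apply: IH; [exact: Cc|exact: Cd].
- by rewrite block_lin; linear_ring.
Qed.

Lemma core0 n : core s l b n 0.
Proof. by apply: simple_core; exact: simple0. Qed.

Lemma coreZ n (k : C) x : core s l b n x -> core s l b n (k *: x).
Proof. by move=> Cx; rewrite -[_ *: _]addr0; apply: core_lin => //; exact: core0. Qed.

Lemma coreD n x y : core s l b n x -> core s l b n y -> core s l b n (x + y).
Proof. by move=> Cx; rewrite -[x]scale1r; exact: core_lin. Qed.

Lemma core_sum n (I : eqType) (r : seq I) (F : I -> A) :
  (forall i, i \in r -> core s l b n (F i)) -> core s l b n (\sum_(i <- r) F i).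
Proof.
move=> CF; rewrite big_seq; apply: big_ind => //; first exact: core0.
exact: coreD.
Qed.

Lemma core_adj n x : core s l b n x -> core s l b n x^#.
Proof.
elim: n x => [|n IH] x /=; first exact: (simple_adj fam).
move=> [x0 [c [Sx Cc ->]]]; exists x0^#, (fun e f => (c f e)^#); split.
- exact: (simple_adj fam).
- by move=> e f es fs; apply: IH; exact: Cc.
- by rewrite cadjD block_adj.
Qed.

Lemma core_block n c : (forall e f, e \in s -> f \in s -> core s l b n (c e f)) ->
  core s l b n.+1 (block s c).
Proof. by move=> Cc; exists 0, c; rewrite add0r; split => //; exact: simple0. Qed.

Lemma range_simple e : e \in s -> simple l b ((t e)^# ** t e).
Proof.
move=> es; have rl := fd_range fd es; rewrite -(fd_le fd rl).
exact: (simple_gen fam).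
Qed.

Lemma simple_block x0 n c : simple l b x0 ->
  (forall e f, e \in s -> f \in s -> core s l b n (c e f)) ->
  core s l b n.+1 (x0 ** block s c).
Proof.
move=> Sx Cc.
have /choice [m mE] : forall e, exists k : C, x0 ** t e = k *: t e.
  by move=> e; exact: (simple_t fam e Pl Pb Sx).
rewrite (_ : x0 ** _ = block s (fun e f => m e *: c e f)).
  by apply: core_block => e f es fs; apply: coreZ; exact: Cc.
rewrite cmul_sumr; apply: eq_bigr => e _; rewrite cmul_sumr; apply: eq_bigr => f _.
by rewrite !cmulA mE !cmulZl cmulZr cmulZl.
Qed.

Lemma core_mul n x y : core s l b n x -> core s l b n y -> core s l b n (x ** y).
Proof.
elim: n x y => [|n IH] x y; first exact: (simple_mul fam).
move=> [x0 [c [Sx Cc ->]]] [y0 [d [Sy Cd ->]]].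
rewrite cmulDl !cmulDr; apply: coreD; apply: coreD.
- by apply: simple_core; exact: (simple_mul fam).
- exact: simple_block.
- rewrite -[_ ** _]cadjK cadjM block_adj; apply/core_adj/simple_block.
    exact: (simple_adj fam).
  by move=> e f es fs; apply: core_adj; exact: Cc.
- rewrite (_ : _ ** _ = block s (fun e h =>
      \sum_(f <- s) c e f ** ((t f)^# ** t f) ** d f h)).
    apply: core_block => e h es hs; apply: core_sum => f fs.
    apply: (IH); last exact: Cd.
    by apply: (IH); [exact: Cc|apply: simple_core; exact: range_simple].
  rewrite {1}/block cmul_suml; apply: eq_big_seq => e es.
  rewrite cmul_suml.
  transitivity (\sum_(f <- s) \sum_(h <- s)
      t e ** (c e f ** ((t f)^# ** t f) ** d f h) ** (t h)^#).
    apply: eq_big_seq => f fs; rewrite -cmulA block_tl // cmul_sumr.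
    by apply: eq_bigr => h _; rewrite !cmulA.
  rewrite exchange_big; apply: eq_bigr => h _ /=.
  by rewrite cmul_sumr cmul_suml.
Qed.

Lemma core_sqn n m x : core s l b n x -> core s l b n (sqn m x).
Proof. by move=> Cx; elim: m => //= m IH; exact: core_mul. Qed.

Lemma corner_core n x e f : e \in s -> f \in s -> core s l b n.+1 x ->
  core s l b n ((t e)^# ** x ** t f).
Proof.
move=> es fs [x0 [c [Sx Cc ->]]]; rewrite cmulDr cmulDl block_corner //.
apply: coreD; last first.
  have range_core g : g \in s -> core s l b n ((t g)^# ** t g).
    by move=> gs; apply: simple_core; exact: range_simple.
  apply: core_mul; last exact: range_core.
  by apply: core_mul; [exact: range_core|exact: Cc].
have [k kE] := simple_t fam f Pl Pb Sx.
rewrite -cmulA kE cmulZr; apply: coreZ.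
have [->|ef] := eqVneq e f; first by apply: simple_core; exact: range_simple.
by rewrite (fam_orth fam ef); exact: core0.
Qed.

Lemma nrm_sandwich (B : cstarAlgType R) (u v y : B) : nrm u <= 1 -> nrm v <= 1 ->
  nrm (cmul (cmul u y) v) <= nrm y.
Proof.
move=> u1 v1; apply: le_trans (nrmM _ _) _; have := nrmM u y.
have := nrm_ge0 u; have := nrm_ge0 v; have := nrm_ge0 y.
have := nrm_ge0 (cmul u y); nra.
Qed.

(** Compress x to the ranges of the edges in s.  The entries of the compression
    lie in the previous level; what is left involves only the projections. *)
Lemma core_bound n : exists2 K : R, 0 <= K &
  forall x, core s l b n x -> nrm x <= K * nrm (pi x).
Proof.
elim: n => [|n [K K0 IH]].
  exists (2 ^+ size l) => [|x Sx]; first exact: exprn_ge0.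
  have sat0 : saturated_edges t src [::] by [].
  have := simple_range_sum_bound (isT : uniq [::]) sat0 Pl Pb Sx.
  by rewrite /range_sum big_nil cmul0r subr0.
pose N : R := (size s)%:R.
have N0 : 0 <= N by exact: ler0n.
have S0 : 0 <= 2 ^+ size l :> R by exact: exprn_ge0.
have NNK : 0 <= N * N * K by rewrite !mulr_ge0.
exists (2 ^+ size l * 2 + N * N * K) => [|x Cx].
  by rewrite addr_ge0 // mulr_ge0.
set c := range_sum t s.
have pit f : nrm (pi (t f)) <= 1 by apply: le_trans (starhom_contr hpi _) (t_nrm fam f).
have corner e f : e \in s -> f \in s ->
    nrm (t e ** ((t e)^# ** x ** t f) ** (t f)^#) <= K * nrm (pi x).
  move=> es fs; apply: le_trans (nrm_sandwich _ (t_nrm fam e) _) _.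
    by rewrite nrm_adj (t_nrm fam).
  apply: le_trans (IH _ (corner_core es fs Cx)) _; rewrite ler_wpM2l //.
  rewrite !(starhomM hpi) (starhom_adj hpi); apply: nrm_sandwich => //.
  by rewrite nrm_adj.
have sumK : nrm (c ** x ** c) <= N * N * K * nrm (pi x).
  rewrite compression; apply: le_trans (nrm_sum _ _) _.
  have -> : N * N * K * nrm (pi x) = \sum_(e <- s) \sum_(f <- s) K * nrm (pi x).
    rewrite !big_const_seq !count_predT !iter_addr_0 /N.
    by rewrite -mulrnA -[RHS]mulr_natl natrM !mulrA.
  rewrite big_seq [leRHS]big_seq; apply: ler_sum => e es.
  apply: le_trans (nrm_sum _ _) _.
  by rewrite big_seq [leRHS]big_seq; apply: ler_sum => f fs; exact: corner.
case: Cx => [x0 [d [Sx Cd xE]]].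
have rest : x - c ** x ** c = x0 - x0 ** c.
  rewrite xE cmulDr cmulDl range_sum_block block_range_sum -(simple_range_sumC fam s Pl Pb Sx).
  by rewrite -cmulA (range_sum_idem fam us); linear_ring.
have bnd := simple_range_sum_bound us (fd_sat fd) Pl Pb Sx; rewrite -/c -rest in bnd.
have c1 : nrm (pi c) <= 1.
  by apply: pi_proj_nrm_le1; [exact: range_sum_sa|exact: (range_sum_idem fam)].
have split_x : nrm x <= nrm (x - c ** x ** c) + nrm (c ** x ** c).
  by rewrite -{1}(subrK (c ** x ** c) x) nrmD.
apply: le_trans split_x _; rewrite mulrDl.
apply: lerD; last exact: sumK.
apply: (le_trans bnd); rewrite -mulrA ler_wpM2l //.
rewrite (starhomB hpi) !(starhomM hpi); apply: le_trans (nrmB _ _) _.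
by have := nrm_sandwich (pi x) c1 c1; lra.
Qed.

(** The pieces are closed under products, so the constant of core_bound serves
    for all powers of x^* x at once. *)
Lemma core_isometric n x : core s l b n x -> nrm x <= nrm (pi x).
Proof.
move=> Cx; have [K K0 hK] := core_bound n.
apply: (@isometric_of_powers _ _ _ _ hpi _ K) => m.
apply: le_trans (hK _ (core_sqn m (core_mul (core_adj Cx) Cx))) _.
rewrite ler_wpM2r ?nrm_ge0 // ler_peMr // -natrX ler1n expn_gt0 //.
Qed.

End Piece.

End Core.

(** * Monomials, the gauge grading and density *)

Section LinearSpan.
Variable R : realType.
Local Notation C := R[i].
Variable A : cstarAlgType R.
Implicit Types (M N : A -> Prop) (x y : A).

Inductive lspan M : A -> Prop :=
| lspan0 : lspan M 0
| lspan_cons (c : C) x y : M x -> lspan M y -> lspan M (c *: x + y).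

Lemma lspan_lin M (c : C) x y : lspan M x -> lspan M y -> lspan M (c *: x + y).
Proof.
move=> Mx My; elim: Mx => [|d u v Mu _ IH]; first by rewrite scaler0 add0r.
have -> : c *: (d *: u + v) + y = (c * d) *: u + (c *: v + y) by linear_ring.
exact: lspan_cons.
Qed.

Lemma lspan1 M x : M x -> lspan M x.
Proof.
by move=> Mx; rewrite -[x]scale1r -[_ *: _]addr0; apply: lspan_cons => //; exact: lspan0.
Qed.

Lemma lspan_mono M N x : (forall y, M y -> N y) -> lspan M x -> lspan N x.
Proof.
move=> MN; elim => [|c u v Mu _ IH]; first exact: lspan0.
by apply: lspan_cons => //; exact: MN.
Qed.

Lemma lspan_mul M N L x y : (forall u v, M u -> N v -> L (cmul u v)) ->
  lspan M x -> lspan N y -> lspan L (cmul x y).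
Proof.
move=> MNL Mx Ny; elim: Mx => [|c u v Mu _ IH]; first by rewrite cmul0l; exact: lspan0.
rewrite cmulDl cmulZl; apply: lspan_lin => // {IH}.
elim: Ny => [|d w z Nw _ IH]; first by rewrite cmul0r; exact: lspan0.
by rewrite cmulDr cmulZr; apply: lspan_cons => //; exact: MNL.
Qed.

Lemma lspan_adj M N x : (forall u, M u -> N (cadj u)) ->
  lspan M x -> lspan N (cadj x).
Proof.
move=> MN; elim => [|c u v Mu _ IH]; first by rewrite cadj0; exact: lspan0.
by rewrite cadjD cadjZ; apply: lspan_cons => //; exact: MN.
Qed.

Definition adherent M x := forall e : R, 0 < e -> exists2 a, M a & nrm (x - a) < e.

Lemma adherent_closed M : closed (adherent M : set A).
Proof.
move=> x xcl e e0; have e20 : 0 < e / 2 by rewrite divr_gt0.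
have ec : 0 < ((e / 2)%:C)%C by rewrite ltcR.
have [y [/= ya]] := xcl _ (nbhsx_ballx x _ ec).
rewrite -ball_normE /ball_ /= nrmE ltcR => xy.
have [a Ma ay] := ya _ e20; exists a => //.
have -> : x - a = (x - y) + (y - a) by linear_ring.
by apply: le_lt_trans (nrmD _ _) _; rewrite [e]splitr; exact: ltrD.
Qed.

Lemma adherent_in M x : M x -> adherent M x.
Proof. by move=> Mx e e0; exists x; rewrite // subrr nrm0. Qed.

Lemma adherent_subalgebra M : (forall x y, M x -> M y -> M (cmul x y)) ->
  (forall x, M x -> M (cadj x)) -> (forall (c : C) x y, M x -> M y -> M (c *: x + y)) ->
  M 0 -> cstar_subalgebra (adherent M : set A).
Proof.
move=> MM Ma Ml M0; split.
- exact: adherent_in.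
- move=> c x y xa ya e e0.
  have d0 : 0 < e / (2 * (cnrm c + 1)).
    by rewrite divr_gt0 // mulr_gt0 // ltr_wpDl ?cnrm_ge0.
  have [a Ma' xd] := xa _ d0; have e20 : 0 < e / 2 by rewrite divr_gt0.
  have [b Mb yd] := ya _ e20; exists (c *: a + b); first exact: Ml.
  have -> : c *: x + y - (c *: a + b) = c *: (x - a) + (y - b) by linear_ring.
  apply: le_lt_trans (nrmD _ _) _; rewrite [e]splitr; apply: ler_ltD => //.
  rewrite nrmZ; move: xd; rewrite ltr_pdivlMr; last first.
    by rewrite mulr_gt0 // ltr_wpDl ?cnrm_ge0.
  by have := cnrm_ge0 c; have := nrm_ge0 (x - a); nra.
- move=> x y xa ya e e0.
  have nx := nrm_ge0 x; have ny := nrm_ge0 y.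
  pose d := Num.min 1 (e / (nrm x + nrm y + 2)).
  have q0 : 0 < e / (nrm x + nrm y + 2) by rewrite divr_gt0 //; lra.
  have d0 : 0 < d by rewrite lt_min ltr01.
  have d1 : d <= 1 by rewrite ge_min lexx.
  have de : d * (nrm x + nrm y + 2) <= e.
    by rewrite -ler_pdivlMr; [rewrite ge_min lexx orbT|lra].
  have [a Ma' xd] := xa _ d0; have [b Mb yd] := ya _ d0.
  exists (cmul a b); first exact: MM.
  have -> : cmul x y - cmul a b = cmul (x - a) y + cmul a (y - b).
    by rewrite cmulBl cmulBr; linear_ring.
  have na : nrm a <= nrm x + 1.
    have -> : a = x - (x - a) by rewrite opprB addrC subrK.
    by apply: le_trans (nrmB _ _) _; lra.
  apply: le_lt_trans (nrmD _ _) _.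
  apply: le_lt_trans (lerD (nrmM _ _) (nrmM _ _)) _.
  have := nrm_ge0 (y - b); have := nrm_ge0 (x - a); have := nrm_ge0 a; nra.
- move=> x xa e e0; have [a Ma' xd] := xa _ e0; exists (cadj a); first exact: Ma.
  by rewrite -cadjB nrm_adj.
- exact: adherent_closed.
Qed.

End LinearSpan.

Section Gauge.
Variable R : realType.
Local Notation C := R[i].
Variables (A D : cstarAlgType R) (E : choiceType).
Variables (P : set A) (t : E -> A) (src : E -> A).
Hypothesis fam : ck_family P t src.
Implicit Types (x y z p r a b : A) (e f g : E) (mu nu al be si : seq E) (k : int).

Local Notation "x ** y" := (cmul x y) (at level 40, left associativity).
Local Notation "x ^#" := (cadj x) (at level 2, format "x ^#").

Definition tpath mu x : A := foldr (fun e y => t e ** y) x mu.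

Lemma tpathM mu x y : tpath mu (x ** y) = tpath mu x ** y.
Proof. by elim: mu => //= e mu ->; rewrite cmulA. Qed.

Lemma tpath_cat mu nu x : tpath (mu ++ nu) x = tpath mu (tpath nu x).
Proof. exact: foldr_cat. Qed.

(** Since 0 is in P, a vanishing product is again of the form tpath mu r; this
    avoids a separate case for it here and in the next lemma. *)
Lemma proj_tpath p mu r : P p -> P r ->
  exists2 r', P r' & p ** tpath mu r = tpath mu r'.
Proof.
move=> Pp Pr; case: mu => [|e mu]; first by exists (p ** r) => //; exact: (famM fam).
rewrite /= cmulA; case: (fam_proj_t fam e Pp) => ->; first by exists r.
exists 0; first exact: (fam0 fam).
suff -> : tpath mu 0 = 0 by rewrite cmul0l cmul0r.
by elim: mu => //= f mu ->; rewrite cmul0r.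
Qed.

(** The shorter path is cancelled against the longer one: the product is a path,
    or the adjoint of a path, of the difference length. *)
Lemma adj_tpath_tpath nu al p r : P p -> P r -> exists si c, P c /\
  (size al = (size nu + size si)%N /\ (tpath nu p)^# ** tpath al r = tpath si c \/
   size nu = (size al + size si)%N /\ (tpath nu p)^# ** tpath al r = (tpath si c)^#).
Proof.
elim: nu al p r => [|e nu IH] al p r Pp Pr.
  have [c Pc cE] := proj_tpath al Pp Pr.
  by exists al, c; split => //; left; rewrite /= (fam_sa fam Pp).
case: al => [|f al].
  have [c Pc cE] := proj_tpath (e :: nu) Pr Pp.
  exists (e :: nu), c; split => //; right; split => //.
  by rewrite -cE cadjM (fam_sa fam Pr).
have Pef : P ((t e)^# ** t f).
  have [->|ef] := eqVneq e f; first exact: (fam_range fam).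
  by rewrite (fam_orth fam ef); exact: (fam0 fam).
have [r' Pr' r'E] := proj_tpath al Pef Pr.
have [si [c [Pc h]]] := IH al p r' Pp Pr'.
exists si, c; split => //=; rewrite cadjM.
have -> : (tpath nu p)^# ** (t e)^# ** (t f ** tpath al r)
    = (tpath nu p)^# ** tpath al r' by rewrite -r'E !cmulA.
by case: h => -[hs hE]; [left|right]; rewrite hE hs addSn.
Qed.

Definition mono mu p nu := tpath mu p ** (tpath nu p)^#.

(** Both paths may end in different projections: each is absorbed by the other
    side, because they commute. *)
Lemma tpath_adj_mono mu nu p r : P p -> P r ->
  tpath mu p ** (tpath nu r)^# = mono mu (p ** r) nu.
Proof.
move=> Pp Pr; have rr := fam_idem fam Pr; have pp := fam_idem fam Pp.
have pr : p ** r ** p = p ** r by rewrite -cmulA (famC fam Pr Pp) cmulA pp.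
have rnu : r ** (tpath nu r)^# = (tpath nu r)^#.
  by rewrite -{1}(fam_sa fam Pr) -cadjM -tpathM rr.
rewrite /mono {2}(famC fam Pp Pr) [tpath nu (_ ** _)]tpathM cadjM (fam_sa fam Pp).
by rewrite [RHS]cmulA -[_ ** p]tpathM pr tpathM -cmulA rnu.
Qed.

Definition monomial k x := exists mu p nu,
  [/\ P p, x = mono mu p nu & k = (size mu)%:Z - (size nu)%:Z].

Lemma monomial_adj k x : monomial k x -> monomial (- k) x^#.
Proof.
move=> [mu [p [nu [Pp -> ->]]]]; exists nu, p, mu; split => //; last by rewrite opprB.
by rewrite /mono cadjM cadjK.
Qed.

Lemma monomial_mul k k' x y : monomial k x -> monomial k' y ->
  monomial (k + k') (x ** y).
Proof.
move=> [mu [p [nu [Pp -> ->]]]] [al [r [be [Pr -> ->]]]].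
have -> : mono mu p nu ** mono al r be
   = tpath mu p ** ((tpath nu p)^# ** tpath al r) ** (tpath be r)^#.
  by rewrite /mono !cmulA.
have [si [c [Pc [[sE ->]|[sE ->]]]]] := adj_tpath_tpath nu al Pp Pr.
  have [c' Pc' c'E] := proj_tpath si Pp Pc.
  rewrite -tpathM c'E -tpath_cat tpath_adj_mono //.
  exists (mu ++ si), (c' ** r), be; split => //; first exact: (famM fam).
  by rewrite size_cat sE !PoszD; ring.
have [c' Pc' c'E] := proj_tpath si Pr Pc.
rewrite -cmulA -cadjM -[tpath be r ** _]tpathM c'E -tpath_cat tpath_adj_mono //.
exists mu, (p ** c'), (be ++ si); split => //; first exact: (famM fam).
by rewrite size_cat sE !PoszD; ring.
Qed.

Lemma monomial_proj p : P p -> monomial 0 p.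
Proof.
move=> Pp; exists [::], p, [::]; split => //.
by rewrite /mono /= (fam_sa fam Pp) (fam_idem fam Pp).
Qed.

Lemma monomial_t e : monomial 1 (t e).
Proof.
have Pr := fam_range fam e; exists [:: e], ((t e)^# ** t e), [::]; split => //.
by rewrite /mono /= (fam_sa fam Pr) -cmulA (fam_idem fam Pr) (fam_pisom fam).
Qed.

Variable pi : A -> D.
Hypothesis hpi : star_hom pi.
Hypothesis pi_faithful : forall p, P p -> pi p = 0 -> p = 0.
Hypothesis t_neq0 : forall e, t e <> 0.

Lemma finite_data_exists mu (l1 : seq A) : {in l1, forall a, P a} ->
  exists s l b, [/\ finite_data P t src s l b, {subset mu <= s} & {subset l1 <= l}].
Proof.
move=> Pl1; have [s [us mus ss]] := saturate fam mu.
pose l := l1 ++ [seq (t e)^# ** t e | e <- s].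
have Pl : {in l, forall a, P a}.
  move=> a; rewrite mem_cat => /orP[/Pl1//|/mapP[e _ ->]]; exact: (fam_range fam).
have [b Pb bl] : exists2 b, P b & {in l, forall a, b ** a = a}.
  elim: l Pl => [|a l IH] Pl; first by exists 0 => //; exact: (fam0 fam).
  have Pa : P a by apply: Pl; rewrite mem_head.
  have [b Pb bl] := IH (in_behead Pl).
  exists (a + b - a ** b); first exact: (famU fam).
  move=> r; rewrite inE => /orP[/eqP ->|rl].
    rewrite cmulBl cmulDl -cmulA (famC fam Pb Pa) !cmulA (fam_idem fam Pa).
    by rewrite addrK.
  by rewrite cmulBl cmulDl -cmulA bl // addrAC subrr add0r.
exists s, l, b; split => //; last by move=> a al; rewrite mem_cat al.
split => // e es; rewrite mem_cat; apply/orP; right; apply/mapP.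
by exists e.
Qed.

Lemma mono_core s l b n mu nu p : finite_data P t src s l b -> p \in l ->
  {subset mu <= s} -> {subset nu <= s} -> size mu = size nu -> (size mu <= n)%N ->
  core t s l b n (mono mu p nu).
Proof.
move=> fd pl; have Pp := fd_proj fd pl.
elim: mu nu n => [|e mu IH] [|f nu] // n mus nus.
  move=> _ _; rewrite /mono /= (fam_sa fam Pp) (fam_idem fam Pp).
  apply: simple_core; rewrite -(fd_le fd pl).
  exact: (simple_gen fam (fd_proj fd) (fd_top fd)).
case: n => // n [sE] sn.
have es : e \in s by apply: mus; rewrite mem_head.
have fs : f \in s by apply: nus; rewrite mem_head.
have Cm : core t s l b n (mono mu p nu).
  apply: IH => //.
    by move=> g gs; apply: mus; rewrite inE gs orbT.
  by move=> g gs; apply: nus; rewrite inE gs orbT.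
pose c e' f' := if (e' == e) && (f' == f) then mono mu p nu else 0.
have -> : mono (e :: mu) p (f :: nu) = block t s c.
  rewrite /block (big_seq_pick (fd_uniq fd) es) => [|g ge]; last first.
    by rewrite big1 // => h _; rewrite /c (negbTE ge) cmul0r cmul0l.
  rewrite (big_seq_pick (fd_uniq fd) fs) => [|g gf]; last first.
    by rewrite /c (negbTE gf) andbF cmul0r cmul0l.
  by rewrite /c !eqxx /mono /= cadjM !cmulA.
apply: core_block => e' f' _ _; rewrite /c.
by case: ifP => // _; exact: core0.
Qed.

Lemma degree0_core x : lspan (monomial 0) x -> exists mu (l1 : seq A) n,
  {in l1, forall a, P a} /\
  forall s l b, finite_data P t src s l b -> {subset mu <= s} -> {subset l1 <= l} ->
    forall n', (n <= n')%N -> core t s l b n' x.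
Proof.
elim => [|c u v [mu [p [nu [Pp -> deg]]]] _ [mu1 [l1 [n [Pl1 h]]]]].
  by exists [::], [::], 0%N; split => // s l b fd _ _ n' _; exact: core0.
exists (mu ++ nu ++ mu1), (p :: l1), (maxn (size mu) n); split.
  by move=> a; rewrite inE => /orP[/eqP ->//|]; exact: Pl1.
move=> s l b fd ms ls n'; rewrite geq_max => /andP[mn nn].
apply: core_lin => //.
  apply: mono_core => //.
  - by apply: ls; rewrite mem_head.
  - by move=> g gm; apply: ms; rewrite mem_cat gm.
  - by move=> g gm; apply: ms; rewrite !mem_cat gm orbT.
  - by move/esym/eqP: deg; rewrite subr_eq0 => /eqP [].
apply: h => // [g gm|a al]; first by apply: ms; rewrite !mem_cat gm !orbT.
by apply: ls; rewrite inE al orbT.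
Qed.

Lemma degree0_isometric x : lspan (monomial 0) x -> nrm x <= nrm (pi x).
Proof.
move=> /degree0_core[mu [l1 [n [Pl1 h]]]].
have [s [l [b [fd mus ls]]]] := finite_data_exists mu Pl1.
exact: (core_isometric fam hpi pi_faithful t_neq0 fd (h s l b fd mus ls n (leqnn n))).
Qed.

(** Isometry passes from the core to the other spectral subspaces, since x^* x has
    degree zero when x is homogeneous. *)
Lemma homogeneous_isometric k x : lspan (monomial k) x -> nrm x <= nrm (pi x).
Proof.
move=> hx; rewrite -(@ler_pXn2r _ 2) ?nnegrE ?nrm_ge0 //.
rewrite -!nrm_adjM -(starhom_adj hpi) -(starhomM hpi).
apply: degree0_isometric.
have := lspan_adj (@monomial_adj k) hx; move=> /lspan_mul; apply; last exact: hx.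
by move=> u v hu hv; have := monomial_mul hu hv; rewrite addNr.
Qed.

Variable gamma : C -> A -> A.
Hypothesis gamma_hom : forall z : C, circle z -> star_hom (gamma z).
Hypothesis gamma_t : forall (z : C) e, circle z -> gamma z (t e) = z *: t e.
Hypothesis gamma_P : forall (z : C) p, circle z -> P p -> gamma z p = p.
Hypothesis gamma_pi : forall (z : C) x, circle z -> nrm (pi (gamma z x)) <= nrm (pi x).

Lemma gamma_monomial (z : C) k x : circle z -> monomial k x ->
  gamma z x = z ^ k *: x.
Proof.
move=> cz [mu [p [nu [Pp -> ->]]]].
have hg := gamma_hom cz.
have gt al : gamma z (tpath al p) = z ^+ size al *: tpath al p.
  elim: al => [|e al IH] /=; first by rewrite gamma_P // expr0 scale1r.
  by rewrite (starhomM hg) IH gamma_t // cmulZl cmulZr scalerA exprS.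
have zn : `|z| = 1 by exact: cz.
have z0 : z != 0 by rewrite -normr_eq0 zn oner_eq0.
rewrite /mono (starhomM hg) (starhom_adj hg) !gt cadjZ cmulZl cmulZr scalerA.
congr (_ *: _); rewrite expfzDr // -exprnP; congr (_ * _).
have -> : Num.conj (z ^+ size nu) = (z ^+ size nu)^-1.
  by rewrite rmorphXn /= invC_norm normrX zn !expr1n invr1 mul1r rmorphXn.
by rewrite exprnN.
Qed.

Definition residue_span (m : nat) (r : int) (d : nat) := lspan (fun x => exists k,
  [/\ monomial k x, (`|k| <= d)%N & exists j : int, k = r + (2 ^ m)%N%:Z * j]).

Lemma root_minus1 m : exists2 w : C, circle w & w ^+ (2 ^ m) = -1.
Proof.
elim: m => [|m [w cw wm]]; first by exists (-1); rewrite ?expr1 // /circle /= normrN1.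
exists (sqrtC w); last by rewrite expnS exprM sqrtCK.
have : `|sqrtC w| ^+ 2 == 1 by rewrite -normrX sqrtCK; apply/eqP.
by rewrite sqrf_eq1 => /orP[/eqP//|/eqP e]; have := normr_ge0 (sqrtC w); rewrite e ler0N1.
Qed.

(** On the degree r + 2^m j the automorphism gamma_w, with w^(2^m) = -1, acts as
    the scalar w^r (-1)^j, so it separates even j from odd j. *)
Lemma residue_split (m : nat) (r : int) (d : nat) (w : C) x : circle w ->
  w ^+ (2 ^ m) = -1 -> residue_span m r d x -> exists x1 x2,
  [/\ residue_span m.+1 r d x1, residue_span m.+1 (r + (2 ^ m)%N%:Z) d x2,
    x = x1 + x2 & gamma w x = w ^ r *: (x1 - x2)].
Proof.
move=> cw wm.
have wn : `|w| = 1 by exact: cw.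
have w0 : w != 0 by rewrite -normr_eq0 wn oner_eq0.
elim => [|c u v [k [hu kd [j kj]]] _ [v1 [v2 [h1 h2 -> hg]]]].
  exists 0, 0; rewrite subrr scaler0 addr0 (starhom0 (gamma_hom cw)).
  by split => //; exact: lspan0.
have wk : w ^ k = w ^ r * (-1) ^ j.
  by rewrite kj expfzDr // -exprz_exp -exprnP wm.
have gE x1 : v1 + v2 = x1 -> gamma w (c *: u + x1)
    = w ^ r *: ((-1) ^ j * c *: u + (v1 - v2)).
  move=> <-; rewrite (starhomD (gamma_hom cw)) hg (starhomZ (gamma_hom cw)).
  by rewrite (gamma_monomial cw hu) wk; linear_ring.
have je := divz_eq j (Posz 2); set i := (j %/ Posz 2)%Z in je.
have jm : (j %% Posz 2)%Z = 0 \/ (j %% Posz 2)%Z = 1.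
  have := @modz_ge0 j (Posz 2) isT; have := @ltz_pmod j (Posz 2) isT.
  by case: (j %% Posz 2)%Z => // -[|[|]] //; [left|right].
case: jm => jm; rewrite jm in je.
  have sj : (-1) ^ j = 1 :> C.
    by rewrite je addr0 mulrC -exprz_exp -exprnP sqrrN expr1n exp1rz.
  exists (c *: u + v1), v2; split => //; first 1 last.
  - by rewrite addrA.
  - by rewrite gE // sj; congr (_ *: _); linear_ring.
  apply: lspan_cons => //; exists k; split => //; exists i.
  by rewrite kj je expnS PoszM; ring.
have sj : (-1) ^ j = -1 :> C.
  rewrite je expfzDr ?oppr_eq0 ?oner_eq0 // mulrC (mulrC i) -exprz_exp -exprnP.
  by rewrite sqrrN expr1n exp1rz mulr1.
exists v1, (c *: u + v2); split => //.
- apply: lspan_cons => //; exists k; split => //; exists i.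
  by rewrite kj je expnS PoszM; ring.
- by linear_ring.
- by rewrite gE // sj; congr (_ *: _); linear_ring.
Qed.

Lemma absz_addle (a b : int) : (`|(a + b)%R| <= `|a| + `|b|)%N.
Proof. by rewrite -lez_nat PoszD !abszE ler_normD. Qed.

Lemma residue_homogeneous m (r : int) d x : (2 * d < 2 ^ m)%N -> residue_span m r d x ->
  exists k, lspan (monomial k) x.
Proof.
move=> dm hx.
have [[j0 j0d]|nj] := pselect (exists j : int, (`|(r + (2 ^ m)%N%:Z * j)%R| <= d)%N).
  exists (r + (2 ^ m)%N%:Z * j0); apply: lspan_mono hx => y [k [hy kd [j kj]]].
  suff <- : j = j0 by rewrite -kj.
  apply: contraTeq dm => jj0; rewrite -leqNgt mul2n -addnn.
  have := absz_addle k (- (r + (2 ^ m)%N%:Z * j0)); rewrite abszN.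
  move/leq_trans/(_ (leq_add kd j0d)); apply: leq_trans.
  have -> : k - (r + (2 ^ m)%N%:Z * j0) = (2 ^ m)%N%:Z * (j - j0) by rewrite kj; ring.
  by rewrite abszM absz_nat leq_pmulr // absz_gt0 subr_eq0.
exists 0; apply: lspan_mono hx => y [k [hy kd [j kj]]].
by case: nj; exists j; rewrite -kj.
Qed.

(** Each halving of the residue class costs a factor 2, so an element with degrees
    bounded by d is controlled up to a factor of order d. *)
Lemma residue_bound i m (r : int) d x : (2 * d < 2 ^ (m + i))%N -> residue_span m r d x ->
  nrm x <= 2 ^+ i * nrm (pi x).
Proof.
elim: i m r x => [|i IH] m r x dm hx.
  rewrite expr0 mul1r; rewrite addn0 in dm.
  by have [k] := residue_homogeneous dm hx; exact: homogeneous_isometric.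
have [w cw wm] := root_minus1 m.
have [x1 [x2 [h1 h2 xE gE]]] := residue_split cw wm hx.
have dm' : (2 * d < 2 ^ (m.+1 + i))%N by rewrite addSnnS.
have wn : `|w| = 1 by exact: cw.
have w0 : w != 0 by rewrite -normr_eq0 wn oner_eq0.
have wr0 : w ^ r != 0 by rewrite expfz_neq0.
have gn : nrm (pi (x1 - x2)) <= nrm (pi x).
  apply: le_trans (gamma_pi x cw); rewrite gE (starhomZ hpi) nrmZ.
  have -> : cnrm (w ^ r) = 1 :> R.
    rewrite /cnrm; case: (r) => n; last rewrite /exprz normfV.
      by rewrite normrX wn expr1n.
    by rewrite normrX wn expr1n invr1.
  by rewrite mul1r.
have b1 := IH _ _ _ dm' h1; have b2 := IH _ _ _ dm' h2.
have half (y : D) : nrm (y + y) <= 2 * nrm (pi x) -> nrm y <= nrm (pi x).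
  have -> : y + y = (2 : R)%:C%C *: y by rewrite rmorph_nat; linear_ring.
  by rewrite nrmZR // ler_pM2l.
have p1 : nrm (pi x1) <= nrm (pi x).
  apply: half; rewrite -(starhomD hpi).
  have -> : x1 + x1 = x + (x1 - x2) by rewrite xE; linear_ring.
  rewrite (starhomD hpi); apply: le_trans (nrmD _ _) _; lra.
have p2 : nrm (pi x2) <= nrm (pi x).
  apply: half; rewrite -(starhomD hpi).
  have -> : x2 + x2 = x - (x1 - x2) by rewrite xE; linear_ring.
  rewrite (starhomB hpi); apply: le_trans (nrmB _ _) _; lra.
apply: (@le_trans _ _ (nrm x1 + nrm x2)); first by rewrite xE nrmD.
apply: le_trans (lerD b1 b2) _; rewrite exprS -mulrA -mulrDr mulrCA.
rewrite ler_pM2l ?exprn_gt0 //; lra.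
Qed.

Definition any_monomial x := exists k, monomial k x.

Lemma algebraic_residue x : lspan any_monomial x -> exists d, residue_span 0 0 d x.
Proof.
elim => [|c u v [k hk] _ [d hd]]; first by exists 0%N; exact: lspan0.
exists (maxn `|k|%N d); apply: lspan_cons.
  exists k; split => //; first by rewrite leq_maxl.
  by exists k; rewrite add0r mul1r.
apply: lspan_mono hd => y [k' [hy kd hj]]; exists k'; split => //.
by rewrite (leq_trans kd) // leq_maxr.
Qed.

Lemma residue_mul d d' x y : residue_span 0 0 d x -> residue_span 0 0 d' y ->
  residue_span 0 0 (d + d') (x ** y).
Proof.
apply: lspan_mul => u v [k [hu kd _]] [k' [hv kd' _]].
exists (k + k'); split; first exact: monomial_mul.
  exact: leq_trans (absz_addle _ _) (leq_add kd kd').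
by exists (k + k'); rewrite add0r mul1r.
Qed.

(** The powers 2^n of x^* x have degrees at most d 2^n, where the loss is a
    factor of order 2^n only; so there is no loss at all. *)
Lemma algebraic_isometric x : lspan any_monomial x -> nrm x <= nrm (pi x).
Proof.
move=> hx; have hxx : lspan any_monomial (x^# ** x).
  have hxa : lspan any_monomial x^#.
    by apply: lspan_adj hx => u [k hu]; exists (- k); exact: monomial_adj.
  apply: lspan_mul hxa hx => u v [k hu] [k' hv].
  by exists (k + k'); exact: monomial_mul.
have [d hd] := algebraic_residue hxx.
have hn n : residue_span 0 0 (d * 2 ^ n) (sqn n (x^# ** x)).
  elim: n => [|n IH]; first by rewrite muln1.
  by rewrite expnS mul2n -addnn mulnDr; exact: residue_mul.
apply: (isometric_of_powers hpi (K := 2 ^+ (2 * d))) => n.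
rewrite -exprD; apply: residue_bound (hn n).
rewrite add0n expnD mulnA ltn_pmul2r ?expn_gt0 //.
exact: ltn_expl.
Qed.

Hypothesis generated : forall S : set A, cstar_subalgebra S ->
  (forall e, S (t e)) -> (forall p, P p -> S p) -> forall x, S x.

(** An element of the kernel is a limit of algebraic elements a; there
    |a| <= |pi a|, and pi a tends to zero. *)
Theorem gauge_invariant_uniqueness : injective pi.
Proof.
have dense x : adherent (lspan any_monomial) x.
  apply: (generated (S := adherent (lspan any_monomial))).
  - apply: adherent_subalgebra.
    + move=> u v; apply: lspan_mul => u' v' [k hk] [k' hk'].
      by exists (k + k'); exact: monomial_mul.
    + move=> u; apply: lspan_adj => u' [k hk].
      by exists (- k); exact: monomial_adj.
    + exact: lspan_lin.
    + exact: lspan0.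
  - by move=> e; apply/adherent_in/lspan1; exists 1; exact: monomial_t.
  - by move=> p Pp; apply/adherent_in/lspan1; exists 0; exact: monomial_proj.
have ker0 x : pi x = 0 -> x = 0.
  move=> px; apply: nrm_eq0; apply/le_anti; rewrite nrm_ge0 andbT.
  apply/ler_addgt0Pr => e e0; rewrite add0r.
  have e20 : 0 < e / 2 by rewrite divr_gt0.
  have [a ha xa] := dense x _ e20.
  have pa : nrm (pi a) <= nrm (x - a).
    rewrite -[leLHS]nrmN -[- pi a]add0r -px -(starhomB hpi).
    exact: (starhom_contr hpi).
  rewrite -[x](subrK a); apply: le_trans (nrmD _ _) _.
  by have := algebraic_isometric ha; lra.
move=> x y xy; apply/eqP; rewrite -subr_eq0; apply/eqP/ker0.
by rewrite (starhomB hpi) xy subrr.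
Qed.

End Gauge.

(** * Representations of a quotient ultragraph *)

Lemma cstar_subalgebra_generated (R : realType) (A : cstarAlgType R) (X : set A) :
  cstar_subalgebra (cstar_generated X).
Proof.
split.
- by move=> S [[S0 _ _ _ _] _].
- move=> c x y gx gy S hS; have [[_ Sl _ _ _] _] := hS.
  by apply: Sl; [exact: gx|exact: gy].
- move=> x y gx gy S hS; have [[_ _ SM _ _] _] := hS.
  by apply: SM; [exact: gx|exact: gy].
- move=> x gx S hS; have [[_ _ _ Sa _] _] := hS.
  by apply: Sa; exact: gx.
- move=> x xcl S hS; have [[_ _ _ _ Sc] _] := hS.
  apply: Sc => U /xcl [y [gy Uy]]; exists y; split => //.
  exact: gy.
Qed.

Section Algebra0.
Variable G : ultragraph.
Implicit Types C D : set (vertex G).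

Lemma algebra0_set1 (v : vertex G) : algebra0 [set v].
Proof. by move=> M [_ h]; apply: h; left; exists v. Qed.
Lemma algebra0_range (e : edge G) : algebra0 (range_of e).
Proof. by move=> M [_ h]; apply: h; right; exists e. Qed.
Lemma algebra0I C D : algebra0 C -> algebra0 D -> algebra0 (C `&` D).
Proof.
move=> hC hD M hM; have [[MI _ _] _] := hM.
by apply: MI; [exact: hC|exact: hD].
Qed.
Lemma algebra0U C D : algebra0 C -> algebra0 D -> algebra0 (C `|` D).
Proof.
move=> hC hD M hM; have [[_ MU _] _] := hM.
by apply: MU; [exact: hC|exact: hD].
Qed.
Lemma algebra0D C D : algebra0 C -> algebra0 D -> algebra0 (C `\` D).
Proof.
move=> hC hD M hM; have [[_ _ MD] _] := hM.
by apply: MD; [exact: hC|exact: hD].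
Qed.

Lemma algebra0_vertex C : algebra0 C -> inhabited (vertex G).
Proof.
move=> hC; apply: contrapT => nv.
suff : @set0 (set (vertex G)) C by [].
apply: hC; split; first by split.
by move=> ? [[v]|[e]]; case: nv; [exact: (inhabits v)|exact: (inhabits (source_of e))].
Qed.

End Algebra0.

Section QuotientFamily.
Variables (G : ultragraph) (H : set (set (vertex G))) (B : set (vertex G)).
Hypothesis hHB : admissible H B.
Local Notation X := (extended_ultragraph H B).
Implicit Types (C D : set (vertex X)) (e f : edge G).

(** A set in H contains no breaking vertex, since all edges starting at a vertex
    of H have their range in H; so the bar operation adds no new vertex to it. *)
Lemma ext_ideal_bar A : H A -> ext_ideal (bar (H := H) (B := B) A).
Proof.
have [[_ Hsub Hr _ Hd] _ _] := hHB => HA.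
exists A => //; apply/seteqP; split => [_ [v Av <-] //|[v|w]] /= Aw.
  by exists v.
have /set_mem[[_ [e [we ne]] _] _] := valP w.
case: ne; apply: Hr; rewrite we; apply: (Hd A) => //; first exact: algebra0_set1.
by move=> _ ->.
Qed.

Lemma ext_ideal_sub A V : algebra0 A -> ext_ideal V ->
  bar (H := H) (B := B) A `<=` V -> ext_ideal (bar (H := H) (B := B) A).
Proof.
have [[_ _ _ _ Hd] _ _] := hHB.
move=> hA [A' HA' <-] AV; apply: ext_ideal_bar; apply: (Hd A') => // v Av.
by have [u Au [<-]] := AV (inl v) Av.
Qed.

(** This is what makes the summation relation available at the source of every
    edge of the quotient. *)
Lemma qvertex_qsource e : qedge H B e -> qvertex (@qsource G H B e).
Proof.
have [[_ _ Hr _ _] _ _] := hHB => qe.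
rewrite /qsource /= /ext_source.
have nv : ~ H [set source_of e].
  by move=> Hv; apply: qe; apply: ext_ideal_bar; exact: Hr.
case: insubP => [w _ _|_]; last by left; exists (source_of e).
case: (pselect _) => ?; first by right; exists w.
by left; exists (source_of e).
Qed.

Lemma qclass_refl C : algebra0 C -> qclass C C.
Proof.
have [[[A HA] _ _ _ _] _ _] := hHB.
move=> hC; split => //.
by exists [set (inl v : vertex X) | v in A] => //; exists A.
Qed.

Lemma qrange_neq0 e : qedge H B e -> @qrange G H B e <> qclass set0.
Proof.
move=> qe e0; have := qclass_refl (algebra0_range (e : edge X)).
rewrite -/(@qrange G H B e) e0 => -[_ [V hV]]; rewrite set0U => VE.
apply: qe; apply: (ext_ideal_sub (algebra0_range e) hV) => x hx.
by rewrite VE; left.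
Qed.

Variables (R : realType) (A : cstarAlgType R).
Variables (t : edge G -> A) (q : set (set (vertex X)) -> A).
Hypothesis rep : representation t q.

Definition rep_projections : set A := [set q a | a in @qalgebra G H B].
Definition qedge_type : choiceType := set_type (qedge H B).
Definition rep_t (e : qedge_type) : A := t (val e).
Definition rep_src (e : qedge_type) : A := q (@qsource G H B (val e)).

Lemma qclassD C D : algebra0 C -> algebra0 D ->
  q (qclass (C `\` D)) = q (qclass C) - cmul (q (qclass C)) (q (qclass D)).
Proof.
move=> hC hD; rewrite -(rep_setI rep) //.
have hI := algebra0I hC hD; have hB := algebra0D hC hD.
have := rep_setU rep hB hI.
rewrite setUC setUIDK (_ : (C `\` D) `&` (C `&` D) = set0).
  by rewrite (rep_set0 rep) subr0 => ->; rewrite addrK.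
by apply/seteqP; split => // x [[_ nDx] [_ /nDx]].
Qed.

Lemma qclassU C D : algebra0 C -> algebra0 D -> q (qclass (C `|` D)) =
  q (qclass C) + q (qclass D) - cmul (q (qclass C)) (q (qclass D)).
Proof. by move=> hC hD; rewrite -(rep_setI rep) // (rep_setU rep). Qed.

Lemma rep_projection_qclass C : algebra0 C -> rep_projections (q (qclass C)).
Proof. by move=> hC; exists (qclass C) => //; exists C. Qed.

Lemma rep_src_inf (v : set (set (vertex X))) (s : seq qedge_type) :
  infinite_set (qemits v) -> exists2 g : qedge_type, g \notin s & qsource (val g) = v.
Proof.
move=> inf; apply: contrapT => nex; apply: inf.
apply: (@sub_finite_set _ _ [set e | e \in map val s]); last exact: finite_seq.
move=> e [qe ev] /=; apply: contrapT => /negP es; apply: nex.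
exists (SigSub (mem_set qe)) => //.
by apply: contraNN es => /(map_f val).
Qed.

Lemma rep_src_fin (v : set (set (vertex X))) : qvertex v -> qemits v !=set0 ->
  finite_set (qemits v) -> exists s : seq qedge_type, [/\ uniq s,
    forall g, g \in s -> qsource (val g) = v &
    q v = \sum_(g <- s) cmul (rep_t g) (cadj (rep_t g))].
Proof.
move=> qv ne fin; rewrite (rep_sum rep qv ne fin) fsbig_finite //=.
set l := finmap.enum_fset _.
have lE e : e \in l -> qemits v e by rewrite in_fset_set // => /set_mem.
pose s : seq qedge_type := pmap insub l.
have sE : map val s = l.
  rewrite /s (pmap_filter (@insubK _ _ _)); apply/all_filterP/allP => e /lE[qe _].
  by rewrite insubT //; exact/mem_set.
exists s; split.
- by rewrite -(map_inj_uniq val_inj) sE finmap.fset_uniq.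
- by move=> f /(map_f val); rewrite sE => /lE[].
- by rewrite -sE big_map.
Qed.

Lemma rep_ck_family : ck_family rep_projections rep_t rep_src.
Proof.
have qe (e : qedge_type) : qedge H B (val e) by exact: set_mem (valP e).
have src_alg e : qalgebra (@qsource G H B e).
  by exists [set source_of (e : edge X)] => //; exact: algebra0_set1.
split.
- have [[[A0 HA0] Hsub _ _ _] _ _] := hHB.
  have [v] := algebra0_vertex (Hsub _ HA0).
  have hv : @algebra0 X [set inl v] by exact: (@algebra0_set1 X (inl v)).
  rewrite -(rep_set0 rep) -(setDv [set inl v]); apply: rep_projection_qclass.
  exact: algebra0D.
- by move=> _ [a qa <-]; case: (rep_projection rep qa).
- by move=> _ [a qa <-]; case: (rep_projection rep qa).
- move=> _ _ [_ [C hC <-] <-] [_ [D hD <-] <-]; rewrite -(rep_setI rep) //.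
  by apply: rep_projection_qclass; exact: algebra0I.
- move=> _ _ [_ [C hC <-] <-] [_ [D hD <-] <-]; rewrite -qclassD //.
  by apply: rep_projection_qclass; exact: algebra0D.
- move=> _ _ [_ [C hC <-] <-] [_ [D hD <-] <-]; rewrite -qclassU //.
  by apply: rep_projection_qclass; exact: algebra0U.
- move=> e; rewrite /rep_t (rep_range rep (qe e)); apply: rep_projection_qclass.
  exact: algebra0_range.
- by move=> e; rewrite cmulA; exact: (rep_partial_isometry rep (qe e)).
- move=> e f ef; apply: (rep_orthogonal rep (qe e) (qe f)).
  by move=> /val_inj efE; rewrite efE eqxx in ef.
- by move=> e; exists (@qsource G H B (val e)).
- move=> e; apply: cle_projection; last exact: (rep_source rep (qe e)).
  exact: (rep_projection rep (src_alg _)).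
- move=> _ e [_ [C hC <-] <-]; rewrite /rep_src /qsource -(rep_setI rep) //; last first.
    exact: algebra0_set1.
  set v := source_of _; have [Cv|nCv] := pselect (C v).
    by left; congr (q (qclass _)); apply/seteqP; split => [x []//|x ->].
  right; rewrite -(rep_set0 rep); congr (q (qclass _)).
  by apply/seteqP; split => // x [Cx xv]; apply: nCv; rewrite -xv.
- move=> e; have qv := qvertex_qsource (qe e).
  have [fin|inf] := pselect (finite_set (qemits (@qsource G H B (val e)))); [right|left].
    have ne : qemits (@qsource G H B (val e)) !=set0.
      by exists (val e); split => //; exact: qe.
    have [s [us sE sum]] := rep_src_fin qv ne fin.
    by exists s; split => // f /sE; rewrite /rep_src => ->.
  move=> s; have [g gs gE] := rep_src_inf s inf.
  by exists g => //; rewrite /rep_src gE.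
Qed.

End QuotientFamily.

(** Each beta_z is a *-homomorphism of C*-algebras, hence a contraction, and this
    bounds pi o gamma_z by pi.  No t_e vanishes, because the range of an edge of
    the quotient has a class different from that of the empty set. *)
Theorem theorem4p5 (R : realType) (G : ultragraph)
    (H : set (set (vertex G))) (B : set (vertex G)) (hHB : admissible H B)
    (A : cstarAlgType R) (t : edge G -> A)
    (q : set (set (vertex (extended_ultragraph H B))) -> A)
    (htq : universal_representation t q)
    (gamma : R[i] -> A -> A) (hgamma : gauge_action t q gamma)
    (D : cstarAlgType R) (T : edge G -> D)
    (Q : set (set (vertex (extended_ultragraph H B))) -> D)
    (hTQ : representation T Q)
    (hQ : forall a : set (set (vertex (extended_ultragraph H B))),
       qalgebra a -> a <> qclass set0 -> Q a <> 0)
    (pi : A -> D) (hpi : star_hom pi)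
    (hpi_range : forall x, rep_algebra T Q (pi x))
    (hpit : forall e, qedge H B e -> pi (t e) = T e)
    (hpiq : forall a : set (set (vertex (extended_ultragraph H B))),
       qalgebra a -> pi (q a) = Q a)
    (beta : R[i] -> D -> D)
    (hbeta : circle_action_on (rep_algebra T Q) beta)
    (hbetapi : forall z x, circle z -> beta z (pi x) = pi (gamma z x)) :
  injective pi.
Proof.
have [rep gen _] := htq; have [[gact _ _ _] gt gq] := hgamma.
have qe (e : qedge_type H B) : qedge H B (val e) by exact: set_mem (valP e).
have faithful p : rep_projections q p -> pi p = 0 -> p = 0.
  move=> [a qa <-]; rewrite hpiq // => Qa0; rewrite -(rep_set0 rep).
  by congr q; apply: contrapT => /(hQ _ qa).
apply: (gauge_invariant_uniqueness (rep_ck_family hHB rep) hpi faithful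
   _ (gamma := gamma)).
- move=> e te0; have qr : qalgebra (@qrange G H B (val e)).
    by exists (range_of (val e : edge (extended_ultragraph H B))) => //; exact: algebra0_range.
  apply: (hQ _ qr (qrange_neq0 hHB (qe e))).
  rewrite -hpiq // -(rep_range rep (qe e)).
  by rewrite (te0 : t (val e) = 0) cmul0r (starhom0 hpi).
- by move=> z cz; have [] := gact z cz.
- by move=> z e cz; exact: gt.
- by move=> z _ cz [a qa <-]; exact: gq.
- move=> z x cz; rewrite -hbetapi //; have [bact _ _ _] := hbeta.
  have [_ bhom] := bact z cz.
  exact: (hom_contractive (cstar_subalgebra_generated _) bhom (hpi_range x)).
- move=> S hS St SP x; have : rep_algebra t q x by rewrite gen.
  apply; split => // _ [[e he <-]|[a ha <-]]; last by apply: SP; exists a.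
  exact: (St (SigSub (mem_set he))).
Qed.
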